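(* Let $M$ be a Seifert 3-manifold which is a rational homology sphere, with orbifold Euler number $e<0$, and put $H=H_1(M,\mathbb{Z})$. Then the Reidemeister-Turaev torsion $\mathcal{T}_{M,\sigma_{can}}(1)$ for the canonical $spin^c$ structure, the Casson-Walker invariant $\lambda(M)$, the invariant $K^2+\#\mathcal V$ and the Dolgachev-Pinkham invariant $DP_M$ satisfy $$\mathcal{T}_{M,\sigma_{can}}(1)+\frac{\lambda(M)}{|H|}=\frac{K^2+\#\mathcal V}{8}+DP_M .$$
   Context: **Seifert invariants.** $M$ is a closed oriented Seifert fibred 3-manifold over $S^2$, with (unnormalized) Seifert invariants $((\alpha_i,\beta_i))_{i=1}^\nu$, $\alpha_i>0$, $\gcd(\alpha_i,\beta_i)=1$, $\nu\ge3$ (the list may include regular fibres, $\alpha_i=1$). Convention: let $\pi:M\to\Sigma$ be the fibration, $D_i\subset\Sigma$ small discs around the images of the distinguished fibres $O_i$, $s$ a section over $\Sigma\setminus\cup D_i$, $Q_i=s(\partial D_i)$, and $H_i$ a fibre over $\partial D_i$; then $H_i\sim\alpha_iO_i$ and $Q_i\sim-\beta_iO_i$ in $H_1(\pi^{-1}(D_i),\mathbb{Z})$. $e=-\sum\beta_i/\alpha_i$; $e<0$ iff $M$ is the link of a normal surface singularity. The normalized invariants are given by $e=b+\sum_i\omega_i/\alpha_i$ with $b\in\mathbb{Z}$, $0\le\omega_i<\alpha_i$, $\omega_i\equiv-\beta_i\pmod{\alpha_i}$. Put $\alpha=\mathrm{lcm}(\alpha_1,\dots,\alpha_\nu)$.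 $H$ (finite, written multiplicatively) is the abelian group generated by $g_0,\dots,g_\nu$ with relations $g_0^{-b}=\prod_i g_i^{\omega_i}$ and $g_0=g_i^{\alpha_i}$ for all $i$, where $g_0$ is the class of the generic fibre; $|H|=\alpha_1\cdots\alpha_\nu|e|$. **$\sigma_{can}$.** If $M$ is the link of $(X,0)$, the (almost) complex structure on $X\setminus\{0\}$ induces a $spin^c$ structure on it, and $\sigma_{can}$ is its restriction to $M$; it depends only on the oriented manifold $M$. **Torsion.** $\mathcal{T}_{M,\sigma}=\sum_{h\in H}\mathcal{T}_{M,\sigma}(h)h\in\mathbb{Q}[H]$ is Turaev's sign-refined Reidemeister torsion of $(M,\sigma)$; $\mathcal{T}_{M,\sigma}(1)$ is the coefficient of the neutral element. It satisfies $\sum_h\mathcal{T}_{M,\sigma}(h)=0$, and for $\sigma_{can}$ it is determined by: for every character $\chi\in\mathrm{Hom}(H,U(1))$, $\chi\neq1$, $$\sum_{h\in H}\mathcal{T}_{M,\sigma_{can}}(h)\chi(h)=\lim_{t\to1}\frac{(t^\alpha\chi(g_0)-1)^{\nu-2}}{\prod_{i=1}^\nu(t^{\alpha/\alpha_i}\chi(g_i)-1)}.$$ **Casson-Walker invariant.** The sign and normalization of $\lambda$ are such that $$\frac{24}{|H|}\lambda(M)=\frac1e\Big(2-\nu+\sum_{i=1}^\nu\frac1{\alpha_i^2}\Big)+e+3+12\sum_{i=1}^\nu s(\beta_i,\alpha_i),$$ where $s(h,k)=\sum_{\mu=0}^{k-1}((\mu/k))((h\mu/k))$ is the Dedekind sum,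 with $((x))=x-\lfloor x\rfloor-\frac12$ for $x\notin\mathbb{Z}$ and $((x))=0$ for $x\in\mathbb{Z}$. **$K^2+\#\mathcal V$.** For a resolution of $(X,0)$ with normal crossing exceptional divisor with components $\{E_v\}_{v\in\mathcal V}$, let $Z_K=\sum_v r_vE_v$ ($r_v\in\mathbb{Q}$) be the unique rational cycle with $Z_K\cdot E_v=E_v\cdot E_v+2$ for all $v$; $K^2:=Z_K\cdot Z_K$ and $\#\mathcal V$ is the number of components. $K^2+\#\mathcal V$ depends only on $M$; it is known that $$K^2+\#\mathcal V=\frac1e\Big(2-\nu+\sum_{i=1}^\nu\frac1{\alpha_i}\Big)^2+e+5+12\sum_{i=1}^\nu s(\beta_i,\alpha_i).$$ **Dolgachev-Pinkham invariant.** $$DP_M:=\sum_{l\ge0}\max\Big(0,\,-1+lb-\sum_{i=1}^\nu\Big\lfloor\frac{-l\omega_i}{\alpha_i}\Big\rfloor\Big).$$ *)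

(* Defs.v *)
From HB Require Import structures.
From mathcomp Require Import all_boot all_order all_algebra.
From mathcomp Require Export complex.
From mathcomp Require Import zify ring lra.
From mathcomp Require Import all_classical all_reals all_analysis.

Set Implicit Arguments.
Unset Strict Implicit.
Unset Printing Implicit Defensive.

Import Order.TTheory GRing.Theory Num.Theory.
Import numFieldNormedType.Exports.

Local Open Scope classical_set_scope.
Local Open Scope ring_scope.

(** ** Seifert invariants *)

(* Unnormalized Seifert invariants of a closed oriented Seifert fibred
   3-manifold over S^2.  Orientation convention: H_i ~ alpha_i O_i and
   Q_i ~ - beta_i O_i, so that e = - \sum_i beta_i / alpha_i.  Regular fibres
   (alpha_i = 1) are allowed in the list. *)
Record seifert := Seifert {
  nu : nat;
  alpha : 'I_nu -> nat;
  beta : 'I_nu -> int;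
  nu_ge3 : (3 <= nu)%N;
  alpha_gt0 : forall i, (0 < alpha i)%N;
  alpha_beta_coprime : forall i, coprimez (alpha i) (beta i)
}.

Definition euler (M : seifert) : rat :=
  - \sum_(i < nu M) (beta i)%:~R / (alpha i)%:R.

Definition omega (M : seifert) (i : 'I_(nu M)) : int :=
  (- beta i %% (alpha i : int))%Z.

Definition seif_b (M : seifert) : int :=
  \sum_(i < nu M) (- beta i %/ (alpha i : int))%Z.

Lemma eulerE (M : seifert) :
  euler M = (seif_b M)%:~R
            + \sum_(i < nu M) (omega i)%:~R / (alpha i)%:R :> rat.
Proof.
rewrite /euler /seif_b -sumrN rmorph_sum -big_split /=.
apply: eq_bigr => i _.
have a0 : (alpha i)%:R != 0 :> rat.
  by rewrite pnatr_eq0 -lt0n alpha_gt0.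
rewrite -mulNr -intrN {1}(divz_eq (- beta i) (alpha i)) intrD intrM.
by rewrite mulrDl -[((alpha i : int)%:~R)]/((alpha i)%:R) mulfK.
Qed.

Definition alpha_lcm (M : seifert) : nat :=
  \big[lcmn/1%N]_(i < nu M) alpha i.

(** ** First homology *)

(* [g] exhibits the abelian group [H], written additively, as the group with
   generators indexed by [I] and relations \sum_i (rel j i) g_i = 0: it induces
   an isomorphism from Z^I modulo the span of the rows of [rel] onto [H]. *)
Definition presented (I J : finType) (rel : J -> I -> int)
    (H : zmodType) (g : I -> H) : Prop :=
  (forall h : H, exists k : I -> int, h = \sum_i g i *~ k i) /\
  (forall k : I -> int,
      \sum_i g i *~ k i = 0 <->
      exists c : J -> int, forall i, k i = \sum_j c j * rel j i).

(* [None] indexes the generic fibre g_0.  The row [None] is the relation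
   b g_0 + \sum_i omega_i g_i = 0, the row [Some i] is g_0 = alpha_i g_i. *)
Definition seif_rel (M : seifert) (j i : option 'I_(nu M)) : int :=
  match j, i with
  | None, None => seif_b M
  | None, Some i => omega i
  | Some _, None => 1
  | Some j, Some i => if j == i then - (alpha j : int) else 0
  end.

(** ** Reidemeister-Turaev torsion of the canonical spin^c structure *)

Definition unitary_char (R : realType) (H : zmodType) (chi : H -> R[i]) : Prop :=
  (forall h, `|chi h| = 1) /\ (forall h h', chi (h + h') = chi h * chi h').

(* [T h] is the coefficient at [h] of an element of Q[H].  The coefficients of
   the torsion are pinned down by their sum and by the Fourier transform at
   nontrivial characters; the latter is a limit at a removable singularity,
   hence the punctured neighbourhood of 1 in the complex numbers. *)
Definition is_torsion_can (R : realType) (M : seifert) (H : finZmodType)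
    (g : option 'I_(nu M) -> H) (T : H -> rat) : Prop :=
  \sum_(h : H) T h = 0 /\
  forall chi : H -> R[i], unitary_char chi -> (exists h, chi h != 1) ->
    (fun t : R[i]^o =>
       (t ^+ alpha_lcm M * chi (g None) - 1) ^+ (nu M - 2)
       / (\prod_(i < nu M)
           (t ^+ (alpha_lcm M %/ alpha i) * chi (g (Some i)) - 1)) : R[i]^o)
      @ (1 : R[i]^o)^' --> (\sum_(h : H) ratr (T h) * chi h : R[i]^o).

(** ** Casson-Walker invariant *)

Definition sawtooth (x : rat) : rat :=
  if x \is a Num.int then 0 else x - (Num.floor x)%:~R - 1 / 2.

Definition dedekind_sum (h : int) (k : nat) : rat :=
  \sum_(0 <= m < k) sawtooth (m%:R / k%:R) * sawtooth (h%:~R * m%:R / k%:R).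

(* The value on Seifert manifolds of the Casson-Walker invariant, with Lescop's
   factor |H| and the sign making it +1 on the Poincare sphere oriented as the
   link of the E8 singularity; [h] is the order of H_1(M, Z). *)
Definition casson_walker (M : seifert) (h : nat) : rat :=
  h%:R / 24 *
  ((euler M)^-1 * (2 - (nu M)%:R + \sum_(i < nu M) ((alpha i)%:R ^+ 2)^-1)
   + euler M + 3 + 12 * \sum_(i < nu M) dedekind_sum (beta i) (alpha i)).

(** ** Resolutions and K^2 + #V *)

(* [negcf [:: k_1; ...; k_s]] is 1 / (k_1 - 1 / (k_2 - ... - 1 / k_s)), and 0
   on the empty list. *)
Definition negcf (s : seq nat) : rat :=
  foldr (fun k x => (k%:R - x)^-1) 0 s.

(* Hirzebruch-Jung expansions alpha_i / omega_i = [k_1, ..., k_s] with all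
   k_j >= 2; the list is empty exactly when omega_i = 0, i.e. alpha_i = 1. *)
Definition HJ_legs (M : seifert) (legs : 'I_(nu M) -> seq nat) : Prop :=
  forall i, all (leq 2) (legs i) /\
            negcf (legs i) = (omega i)%:~R / (alpha i)%:R.

Lemma negcf_exists (a w : nat) : (w < a)%N ->
  exists s, all (leq 2) s /\ negcf s = w%:R / a%:R.
Proof.
elim/ltn_ind: a w => a IH [|w'] ltwa; first by exists [::]; rewrite mul0r.
set w := w'.+1 in ltwa *; pose k := ((a + w') %/ w)%N.
have ed := divn_eq (a + w') w; rewrite -/k in ed.
have lm : ((a + w') %% w < w)%N by rewrite ltn_mod.
have le_a : (a <= k * w)%N by rewrite /w in ed lm *; lia.
have lt_w : (k * w - a < w)%N by rewrite /w in ed lm *; lia.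
have [s [s2 sE]] := IH w ltwa _ lt_w.
have k2 : (2 <= k)%N by case: (k) le_a => [|[|//]]; rewrite ?mul0n ?mul1n; lia.
exists (k :: s); split; first by rewrite /= k2.
rewrite /= sE natrB // natrM.
have w0 : w%:R != 0 :> rat by rewrite pnatr_eq0.
have a0 : a%:R != 0 :> rat by rewrite pnatr_eq0; case: (a) ltwa.
by rewrite mulrBl mulfK // opprB addrC subrK invf_div.
Qed.

Lemma HJ_legs_exist (M : seifert) :
  exists legs : 'I_(nu M) -> seq nat, HJ_legs legs.
Proof.
suff /choice[legs h] : forall i : 'I_(nu M), exists s : seq nat,
    all (leq 2) s /\ negcf s = (omega i)%:~R / (alpha i)%:R by exists legs.
move=> i; have a0 := alpha_gt0 i.
have := ltz_pmod (- beta i) (a0 : 0 < (alpha i : int)).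
have := modz_ge0 (- beta i) (lt0r_neq0 (a0 : 0 < (alpha i : int))).
rewrite -/(omega i); case: (omega i) => // w _ ltwa.
exact: negcf_exists.
Qed.

Definition star_vertex (M : seifert) (legs : 'I_(nu M) -> seq nat) : finType :=
  option {i : 'I_(nu M) & 'I_(size (legs i))}.

(* Intersection form of the star-shaped plumbing: [None] is the central curve,
   and the curves of the i-th leg are numbered from 0 starting at the centre. *)
Definition star_form (M : seifert) (legs : 'I_(nu M) -> seq nat)
    (x y : star_vertex legs) : int :=
  match x, y with
  | None, None => seif_b M
  | None, Some q | Some q, None => if tagged q == 0%N :> nat then 1 else 0
  | Some p, Some q =>
      if tag p != tag q then 0
      else if tagged p == tagged q :> nat
           then - (nth 0%N (legs (tag p)) (tagged p) : int)
      else if (tagged p == (tagged q).+1 :> nat)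
              || (tagged q == (tagged p).+1 :> nat) then 1
      else 0
  end.

(* The curves through a point of a normal crossing divisor, given by the
   intersection numbers of its components. *)
Definition blowup_center (V : finType) (E : V -> V -> int) (S : {set V}) : Prop :=
  (exists v, S = [set v]%SET) \/
  (exists u v, [/\ u != v, E u v = 1 & S = [set u; v]%SET]).

(* [None] is the exceptional (-1)-curve, [Some v] the strict transform of v. *)
Definition blowup (V : finType) (E : V -> V -> int) (S : {set V})
    (x y : option V) : int :=
  match x, y with
  | None, None => -1
  | None, Some v | Some v, None => (v \in S)%:R
  | Some u, Some v => E u v - (u \in S)%:R * (v \in S)%:R
  end.

(* Intersection forms of the normal crossing resolutions of the singularities
   with link [M]: since any two such resolutions are related by blow-ups and
   blow-downs, these are obtained in this way from the star-shaped plumbing.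
   All the components are smooth rational curves and the dual graph is a tree. *)
Inductive resolution (M : seifert) : forall V : finType, (V -> V -> int) -> Prop :=
| Res_star (legs : 'I_(nu M) -> seq nat) :
    HJ_legs legs -> resolution M (@star_form M legs)
| Res_iso (V W : finType) (E : V -> V -> int) (F : W -> W -> int) (f : V -> W) :
    bijective f -> (forall u v, F (f u) (f v) = E u v) ->
    resolution M E -> resolution M F
| Res_blowup (V : finType) (E : V -> V -> int) (S : {set V}) :
    blowup_center E S -> resolution M E -> resolution M (blowup E S)
| Res_blowdown (V : finType) (E : V -> V -> int) (S : {set V}) :
    blowup_center E S -> resolution M (blowup E S) -> resolution M E.

Definition cycle_dot (V : finType) (E : V -> V -> int) (Y Z : V -> rat) : rat :=
  \sum_u \sum_v Y u * Z v * (E u v)%:~R.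

Definition canonical_cycle (V : finType) (E : V -> V -> int) (Z : V -> rat) : Prop :=
  forall v, \sum_u Z u * (E u v)%:~R = (E v v + 2)%:~R.

Definition K2_plus_V (V : finType) (E : V -> V -> int) (Z : V -> rat) : rat :=
  cycle_dot E Z Z + #|V|%:R.

(** ** Dolgachev-Pinkham invariant *)

Definition DP_term (M : seifert) (l : nat) : int :=
  Num.max 0 (- 1 + l%:Z * seif_b M
     - \sum_(i < nu M) Num.floor (- (l%:R * (omega i)%:~R) / (alpha i)%:R : rat)).

(* The sum of a finitely supported family; see [DP_term_finite]. *)
Definition DP (M : seifert) : int := \sum_(l \in [set: nat]) DP_term M l.

Lemma DP_term_eq0 (M : seifert) (l : nat) :
  (nu M)%:R <= l%:R * - euler M -> DP_term M l = 0.
Proof.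
move=> hl; rewrite /DP_term; apply/max_idPl.
rewrite eulerE in hl; move: (seif_b M) hl => b hl.
rewrite -(ler_int rat) rmorphB rmorphD /= rmorphM /= rmorph_sum /=.
set A := \sum_(i < _) _.
have hA : - A <= l%:R * (\sum_(i < nu M) (omega i)%:~R / (alpha i)%:R) + (nu M)%:R.
  rewrite /A -sumrN mulr_sumr -[X in _ + X%:R](card_ord (nu M)) -sum1_card.
  rewrite natr_sum -big_split /=; apply: ler_sum => i _.
  rewrite mulNr -mulrA; set y := _ * (_ / _).
  by have := floorD1_gt (- y); rewrite intrD; lra.
have -> : (l : int)%:~R = l%:R :> rat by [].
rewrite mulr0z; move: hl hA; rewrite mulrN mulrDr; lra.
Qed.

Lemma DP_term_finite (M : seifert) : euler M < 0 ->
  exists N, forall l, (N <= l)%N -> DP_term M l = 0.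
Proof.
move=> he; pose x := (nu M)%:R / - euler M.
exists (Num.bound x) => l hl; apply: DP_term_eq0.
have e0 : 0 < - euler M by rewrite oppr_gt0.
rewrite -ler_pdivrMr //; apply: (@le_trans _ _ (Num.bound x)%:R).
  by apply/ltW/archi_boundP; rewrite divr_ge0 // ltW.
by rewrite ler_nat.
Qed.

(* Main.v *)
Require Import Defs.
From HB Require Import structures.
From mathcomp Require Import all_boot all_order all_algebra.
From mathcomp Require Import all_fingroup all_solvable all_field all_character.
From mathcomp Require Import complex zify ring lra.
From mathcomp Require Import all_classical all_reals all_analysis.

(* By Fourier inversion T(1) is 1/|H| times the sum of the limits at t = 1 over
   the nontrivial characters.  Since g_i ^ alpha_i = g_0, and since g_0 ^ n = 1
   for n = alpha |e|, the summand of chi is G_chi(t) / (t ^ (alpha n) - 1) ^ 2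
   with G_chi a polynomial; hence the sum P of the G_chi over the nontrivial
   characters vanishes to order 2 at 1, and P''(1) computes T(1).  Summing over
   all the characters keeps in the expansion of G_chi the exponents of words
   equal to 1 in H.  These words are indexed by m >= 0, with degree m n and
   multiplicity a second difference of max(0, 1 + N(m)), where
   N(m) = - m b + sum_i floor(- m omega_i / alpha_i).  As max(0, 1 + N) is
   1 + N + max(0, - 1 - N), summation by parts gives DP plus a sum over one
   period, where the Dedekind sums appear.  The trivial character is a product
   of uniform laws, so that only its mean and variance are needed.
   On the other side K^2 + #V is invariant under blow-ups,
     and on the star-shaped
   plumbing it follows from the adjunction formula along each leg together with
   Dedekind reciprocity. *)

Set Implicit Arguments.
Unset Strict Implicit.
Unset Printing Implicit Defensive.

Import Order.TTheory GRing.Theory Num.Theory.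
Import numFieldNormedType.Exports.

Local Open Scope classical_set_scope.
Local Open Scope ring_scope.

(** * Dedekind sums *)

Lemma big_option (V : nmodType) (I : finType) (F : option I -> V) :
  \sum_x F x = F None + \sum_i F (Some i).
Proof.
rewrite (bigD1 None) //=; congr (_ + _).
rewrite (reindex_omap Some id) => [|[]//].
by apply: eq_bigl => i; rewrite eqxx.
Qed.

Lemma sumr_ord (F : numFieldType) (n : nat) :
  \sum_(i < n) (i%:R : F) = n%:R * (n%:R - 1) / 2.
Proof.
elim: n => [|n IH]; first by rewrite big_ord0 mul0r mul0r.
by rewrite big_ord_recr /= IH -natr1; field.
Qed.

Lemma sumr_ord_sqr (F : numFieldType) (n : nat) :
  \sum_(i < n) (i%:R ^+ 2 : F) = n%:R * (n%:R - 1) * (2 * n%:R - 1) / 6.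
Proof.
elim: n => [|n IH]; first by rewrite big_ord0 !mul0r.
by rewrite big_ord_recr /= IH -natr1; field.
Qed.

Lemma floor_divz (F : archiRealFieldType) (z : int) (k : nat) : (0 < k)%N ->
  Num.floor (z%:~R / k%:R : F) = (z %/ k)%Z.
Proof.
move=> k0; have k0F : 0 < k%:R :> F by rewrite ltr0n.
have k0z : (k : int) != 0 by rewrite gt_eqF.
apply: floor_def; rewrite ler_pdivlMr // ltr_pdivrMr //.
rewrite -[k%:R]/((k : int)%:~R) -!intrM ler_int ltr_int.
rewrite {2 3}(divz_eq z k) mulrDl mul1r lerDl ltrD2l modz_ge0 //=.
exact: ltz_pmod.
Qed.

Lemma divz_rat (F : numFieldType) (z : int) (k : nat) : (0 < k)%N ->
  (z %/ k)%Z%:~R = (z%:~R - (z %% k)%Z%:~R) / k%:R :> F.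
Proof.
move=> k0; have k0F : k%:R != 0 :> F by rewrite pnatr_eq0 -lt0n.
by rewrite {2}(divz_eq z k) intrD addrK intrM mulfK.
Qed.

Lemma sawtoothE (z : int) (k : nat) : (0 < k)%N ->
  sawtooth (z%:~R / k%:R) =
    if (k %| z)%Z then 0 else (z %% k)%Z%:~R / k%:R - 1 / 2.
Proof.
move=> k0; have k0F : k%:R != 0 :> rat by rewrite pnatr_eq0 -lt0n.
rewrite /sawtooth floor_divz //.
have -> : (z%:~R / k%:R : rat) \is a Num.int = (k %| z)%Z.
  apply/idP/idP => [/intrP[m hm]|/dvdzP[q ->]].
    apply/dvdzP; exists m; apply/eqP; rewrite -(eqr_int rat) intrM -hm.
    by rewrite -[((k : int)%:~R)]/(k%:R) divfK.
  by rewrite intrM mulfK // intr_int.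
by case: ifP => // _; rewrite divz_rat //; field.
Qed.

(** By coprimality neither sawtooth argument is an integer for [0 < r < k], so each factor is a
    residue over [k] minus 1/2. *)
Lemma dedekind_sumE (h : int) (k : nat) : (0 < k)%N -> coprimez k h ->
  dedekind_sum h k =
    (\sum_(r < k) r%:R * ((h * r) %% k)%Z%:~R) / k%:R ^+ 2 - (k%:R - 1) / 4
    - (\sum_(r < k) ((h * r) %% k)%Z%:~R - k%:R * (k%:R - 1) / 2) / k%:R / 2.
Proof.
move=> k0 cop; have kF : k%:R != 0 :> rat by rewrite pnatr_eq0 -lt0n.
rewrite /dedekind_sum big_mkord.
(* At [r = 0] the two affine expressions multiply to 1/4 whereas the sawtooth product is 0; the
   conditional removes this excess. *)
rewrite (eq_bigr (fun r : 'I_k => (r%:R / k%:R - 1 / 2)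
    * (((h * r) %% k)%Z%:~R / k%:R - 1 / 2) - (if r == 0 :> nat then 4^-1 else
      0))).
  case: k k0 cop kF => // k k0 cop kF.
  rewrite sumrB [X in _ - X = _]big_ord_recl /= [X in _ - (_ + X) = _]big1 //
    addr0.
  rewrite (eq_bigr (fun r : 'I_k.+1 => r%:R * ((h * r) %% k.+1)%Z%:~R /
    k.+1%:R ^+ 2
     - ((h * r) %% k.+1)%Z%:~R / k.+1%:R / 2 - r%:R / k.+1%:R / 2 + 4^-1)).
    rewrite big_split !sumrB /= -!mulr_suml sumr_ord sumr_const card_ord
      -mulr_natl.
    by field.
  by move=> i _; field.
move=> [r rk] _ /=.
rewrite -[r%:R]/((r : int)%:~R) -intrM !sawtoothE //.
have kr : (k %| (r : int))%Z = (r == 0)%N.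
  rewrite -[(k %| (r : int))%Z]/(k %| r)%N; apply/idP/eqP => [|->//].
  by case: r rk => // r rk /(dvdn_leq (ltn0Sn r)); rewrite leqNgt rk.
have -> : (k %| h * r)%Z = (r == 0)%N by rewrite Gauss_dvdzr.
rewrite kr modz_small ?rk //.
by case: ifP => [/eqP->|_]; rewrite ?mulr0 ?mod0z; [field|rewrite subr0].
Qed.

(** Multiplication by a unit permutes the residues: if [k] divides [h * (r - s)], it divides
    [r - s], which is less than [k]. *)
Lemma sum_mulmod (V : nmodType) (f : nat -> V) (h k : nat) : coprime k h ->
  \sum_(r < k) f ((h * r) %% k)%N = \sum_(r < k) f r.
Proof.
case: k => [|k] cop; first by rewrite !big_ord0.
rewrite [RHS](reindex_inj (h := fun r : 'I_k.+1 =>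
  inord ((h * r) %% k.+1)%N)) /=.
  by apply: eq_bigr => r _; rewrite inordK // ltn_mod.
move=> r s /(congr1 val); rewrite /= !inordK ?ltn_mod // => /eqP.
wlog le_rs : r s / (r <= s)%N => [hw|].
  by case/orP: (leq_total r s) => le; [exact: hw|rewrite eq_sym => /hw->].
rewrite eq_sym eqn_mod_dvd ?leq_mul2l ?le_rs ?orbT // -mulnBr Gauss_dvdr //.
move=> /dvdn_leq; case: (posnP (s - r)%N) => [/eqP|sr0 /(_ isT)].
  by rewrite subn_eq0 => sr _; apply/val_inj/eqP; rewrite eqn_leq le_rs.
by rewrite leqNgt (leq_ltn_trans (leq_subr _ _) (ltn_ord s)).
Qed.

Lemma sum_mulmodz (F : numFieldType) (h : int) (k : nat) (f : int -> F) :
  (0 < k)%N -> coprimez k h ->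
  \sum_(r < k) f ((h * r) %% k)%Z = \sum_(r < k) f r.
Proof.
move=> k0 cop.
have h0 : 0 <= (h %% k)%Z by rewrite modz_ge0 // gt_eqF.
rewrite -(@sum_mulmod _ (fun r : nat => f r) (absz (h %% k)%Z)); last first.
  by move: cop; rewrite /coprimez -gcdz_modr /gcdz /coprime absz_nat.
apply: eq_bigr => r _; congr f.
by rewrite -modzMml -[in LHS](gez0_abs h0) -PoszM modz_nat.
Qed.

(** Since the residues are permuted, the last term of [dedekind_sumE] vanishes. *)
Lemma dedekind_sum_coprime (h : int) (k : nat) : (0 < k)%N -> coprimez k h ->
  dedekind_sum h k =
    (\sum_(r < k) r%:R * ((h * r) %% k)%Z%:~R) / k%:R ^+ 2 - (k%:R - 1) / 4.
Proof.
move=> k0 cop; rewrite dedekind_sumE //.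
by rewrite (sum_mulmodz (fun z => z%:~R)) // sumr_ord subrr !mul0r subr0.
Qed.

Lemma dedekind_sum_modl (h h' : int) (k : nat) : (0 < k)%N ->
  (h = h' %[mod k])%Z -> dedekind_sum h k = dedekind_sum h' k.
Proof.
move=> k0 hh; rewrite /dedekind_sum !big_mkord; apply: eq_bigr => r _.
rewrite -[r%:R]/((r : int)%:~R) -!intrM !sawtoothE //.
have e : (h * r = h' * r %[mod k])%Z by rewrite -modzMml hh modzMml.
have -> : (k %| h * r)%Z = (k %| h' * r)%Z; last by rewrite e.
by apply/dvdz_mod0P/dvdz_mod0P; rewrite e.
Qed.

Lemma dedekind_sumN (h : int) (k : nat) : (0 < k)%N ->
  dedekind_sum (- h) k = - dedekind_sum h k.
Proof.
move=> k0; rewrite /dedekind_sum -sumrN; apply: eq_big_nat => m _.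
rewrite -mulrN; congr (_ * _).
rewrite -[m%:R]/((m : int)%:~R) -!intrM !sawtoothE // mulNr rpredN.
case: ifP => [_|/negbT ndv]; first by rewrite oppr0.
have k0F : k%:R != 0 :> rat by rewrite pnatr_eq0 -lt0n.
have -> : ((- (h * m)) %% k)%Z = k%:Z - ((h * m) %% k)%Z.
  have kz : (0 : int) < k by [].
  have m0 : ((h * m) %% k)%Z != 0 by apply: contraNneq ndv => /dvdz_mod0P.
  have := modz_ge0 (h * m) (lt0r_neq0 kz); have := ltz_pmod (h * m) kz.
  move=> lt ge; rewrite {1}(divz_eq (h * m) k).
  have -> : - ((h * m %/ k)%Z * k + (h * m %% k)%Z) =
    (- (h * m %/ k)%Z - 1) * k + (k%:Z - (h * m %% k)%Z) by ring.
  rewrite modzMDl modz_small // subr_ge0 (ltW lt) ltrBlDr ltrDl.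
  by rewrite lt0r m0.
by rewrite intrB -[((k : int)%:~R)]/(k%:R); field.
Qed.

(* Both sides weigh by [2 j] the lattice points [(r, j)] with [r < k], [j < h],
   according to whether [j k <= h r] or not. *)
Lemma sum_divn_swap (h k : nat) : (0 < h)%N -> (0 < k)%N -> coprime h k ->
  (\sum_(r < k) (h * r %/ k) * (h * r %/ k).+1
   + 2 * \sum_(j < h) j * (j * k %/ h) = k.-1 * (h * h.-1))%N.
Proof.
move=> h0 k0 cop.
have wsum n : (\sum_(j < n) 2 * j = n * n.-1)%N.
  elim: n => [|n IH]; first by rewrite big_ord0.
  by rewrite big_ord_recr /= IH; case: (n) => //= m; lia.
(* The product [c * c.+1] is the sum of [2 * j] over [j <= c], here the weight of the column at
   [r]. *)
have colE (r : 'I_k) : ((h * r %/ k) * (h * r %/ k).+1 =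
    \sum_(j < h) if j * k <= h * r then 2 * j else 0)%N.
  have lt : (h * r %/ k < h)%N by rewrite ltn_divLR // ltn_pmul2l.
  rewrite -big_mkcond /= mulnC -{2}[(h * r %/ k)%N]/((h * r %/ k).+1.-1)%N
    -wsum.
  rewrite (big_ord_widen_cond h xpredT (fun j => 2 * j)%N) //.
  by apply: eq_bigl => j; rewrite ltnS leq_divRL.
(* For [0 < j < h] coprimality excludes [j * k = h * r], so row [j] omits exactly the
   [(j * k %/ h).+1] values [r <= j * k %/ h]. Row 0 has weight 0. *)
have rowE (j : 'I_h) : ((\sum_(r < k) if j * k <= h * r then 2 * j else 0)
    + 2 * (j * (j * k %/ h)) = k.-1 * (2 * j))%N.
  case: (posnP j) => [->|j0].
    by rewrite big1 ?muln0 // => r _; case: ifP.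
  have ndv : ~~ (h %| j * k)%N.
    rewrite Gauss_dvdl //; apply/negP => /(dvdn_leq j0).
    by rewrite leqNgt ltn_ord.
  have lt : (j * k %/ h < k)%N by rewrite ltn_divLR // mulnC ltn_pmul2l.
  have -> : (\sum_(r < k) (if j * k <= h * r then 2 * j else 0)
      = \sum_(r < k) if (j * k %/ h) < r then 2 * j else 0)%N.
    apply: eq_bigr => r _; rewrite ltn_divLR // [(r * h)%N]mulnC.
    rewrite (leq_eqVlt (j * k)); case: eqP => //= e.
    by rewrite e dvdn_mulr in ndv.
  have cnt : (\sum_(r < k) (if r <= (j * k %/ h) then 2 * j else 0)
      = (j * k %/ h).+1 * (2 * j))%N.
    rewrite -big_mkcond /= -(big_ord_widen k (fun=> 2 * j)%N lt).
    by rewrite sum_nat_const card_ord.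
  have tot : (\sum_(r < k) (if (j * k %/ h) < r then 2 * j else 0)
      + \sum_(r < k) (if r <= (j * k %/ h) then 2 * j else 0) = k * (2 * j))%N.
    rewrite -big_split /= (eq_bigr (fun=> 2 * j)%N).
      by rewrite sum_nat_const card_ord.
    by move=> r _; case: (leqP r (j * k %/ h)); rewrite ?addn0.
  move: tot; rewrite cnt; case: (k) k0 => //= m _.
  by rewrite !mulSn; lia.
rewrite (eq_bigr _ (fun r _ => colE r)) exchange_big /= big_distrr /=
  -big_split /=.
by rewrite (eq_bigr _ (fun j _ => rowE j)) -big_distrr /= wsum.
Qed.

(** Replacing each quotient by dividend minus residue over divisor turns [sum_divn_swap] into a
    linear relation between [D] and [D']; the sums of residues and of their squares are explicit by
    permutation. *)
Lemma dedekind_reciprocity (h k : nat) : (0 < h)%N -> (0 < k)%N -> coprime h k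
  ->
  dedekind_sum h k + dedekind_sum k h =
    - (1 / 4) + (h%:R / k%:R + k%:R / h%:R + (h%:R * k%:R)^-1) / 12.
Proof.
move=> h0 k0 cop.
have hF : h%:R != 0 :> rat by rewrite pnatr_eq0 -lt0n.
have kF : k%:R != 0 :> rat by rewrite pnatr_eq0 -lt0n.
have divE (a b : nat) : (0 < b)%N ->
    (a %/ b)%:R = (a%:R - (a %% b)%:R) / b%:R :> rat.
  move=> b0; have bF : b%:R != 0 :> rat by rewrite pnatr_eq0 -lt0n.
  by rewrite {2}(divn_eq a b) natrD addrK natrM mulfK.
rewrite !dedekind_sum_coprime ?/coprimez // ; last first.
  by rewrite /gcdz !absz_nat gcdnC.
have modE (a b r : nat) : ((a%:Z * r) %% b)%Z%:~R = ((a * r) %% b)%N%:R :> rat.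
  by rewrite -PoszM modz_nat.
under eq_bigr do rewrite modE.
under [X in _ + (X / _ - _)]eq_bigr do rewrite modE.
set D := \sum_(r < k) _; set D' := \sum_(r < h) _.
have := congr1 (fun n : nat => n%:R : rat) (sum_divn_swap h0 k0 cop).
rewrite natrD !natrM !natr_sum.
have -> : k.-1%:R = k%:R - 1 :> rat by case: (k) k0 => // m _;
  rewrite -natr1 addrK.
have -> : h.-1%:R = h%:R - 1 :> rat by case: (h) h0 => // m _;
  rewrite -natr1 addrK.
have mod1 : \sum_(r < k) ((h * r) %% k)%:R = k%:R * (k%:R - 1) / 2 :> rat.
  by rewrite (sum_mulmod (fun x => x%:R)) ?sumr_ord // coprime_sym.
have mod2 : \sum_(r < k) ((h * r) %% k)%:R ^+ 2 =
    k%:R * (k%:R - 1) * (2 * k%:R - 1) / 6 :> rat.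
  by rewrite (sum_mulmod (fun x => x%:R ^+ 2)) ?sumr_ord_sqr // coprime_sym.
have -> : \sum_(r < k) (h * r %/ k * (h * r %/ k).+1)%:R =
   ((h%:R ^+ 2 + 1) * (k%:R * (k%:R - 1) * (2 * k%:R - 1) / 6) - 2 * h%:R * D)
     / k%:R ^+ 2 + (h%:R - 1) * (k%:R * (k%:R - 1) / 2) / k%:R :> rat.
  rewrite (eq_bigr (fun r : 'I_k => h%:R ^+ 2 / k%:R ^+ 2 * r%:R ^+ 2
      + (k%:R ^+ 2)^-1 * ((h * r) %% k)%:R ^+ 2
      - (2 * h%:R / k%:R ^+ 2) * (r%:R * ((h * r) %% k)%:R)
      + h%:R / k%:R * r%:R - k%:R^-1 * ((h * r) %% k)%:R)).
    rewrite sumrB big_split /= sumrB big_split /= -!mulr_sumr.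
    by rewrite mod1 mod2 sumr_ord sumr_ord_sqr -/D; field.
  by move=> r _; rewrite natrM -natr1 divE // natrM; field.
have -> : \sum_(j < h) (j * (j * k %/ h))%:R =
   (k%:R * (h%:R * (h%:R - 1) * (2 * h%:R - 1) / 6) - D') / h%:R :> rat.
  rewrite -sumr_ord_sqr mulr_sumr -sumrB mulr_suml; apply: eq_bigr => j _.
  rewrite natrM divE // [(k * j)%N]mulnC natrM.
  by field.
move: D D' => D D' e.
have {e}-> : D' = k%:R * (h%:R * (h%:R - 1) * (2 * h%:R - 1) / 6)
  - h%:R / 2 * ((k%:R - 1) * (h%:R * (h%:R - 1)) - 
  (((h%:R ^+ 2 + 1) * (k%:R * (k%:R - 1) * (2 * k%:R - 1) / 6) - 2 * h%:R * D)
     / k%:R ^+ 2 + (h%:R - 1) * (k%:R * (k%:R - 1) / 2) / k%:R)).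
  by rewrite -e; field; rewrite hF kF.
by field; rewrite hF kF.
Qed.

(** * K^2 + #V *)

Lemma negcf_ge0_lt1 (s : seq nat) : all (leq 2) s -> 0 <= negcf s < 1.
Proof.
elim: s => [|k s IH] //= /andP[k2 /IH/andP[ge lt]].
have {}k2 : 2 <= k%:R :> rat by rewrite ler_nat.
have d1 : 1 < k%:R - negcf s by lra.
by rewrite invr_ge0 invf_lt1 ?d1 ?ltW //; lra.
Qed.

(* With [y_j] the multiplicity along the leg minus 1, the recurrence is
   the adjunction formula; [w'] is the inverse of [w] modulo [a]. *)
Lemma leg_recurrence (s : seq nat) (a w : nat) :
  (0 < a)%N -> coprime a w -> all (leq 2) s -> negcf s = w%:R / a%:R ->
  exists w' : rat,
    12 * dedekind_sum w a = (w%:R + w') / a%:R + \sum_(k <- s) (k%:R - 3) /\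
    forall y : nat -> rat,
      (forall j, (j < size s)%N ->
         y j - (nth 0%N s j)%:R * y j.+1 + y j.+2 = 0) ->
      a%:R * y 1%N = w%:R * y 0%N + y (size s).+1 /\
      a%:R * y (size s) = y 0%N + w' * y (size s).+1.
Proof.
elim: s a w => [|k s IH] a w a0 cop.
  have aF : a%:R != 0 :> rat by rewrite pnatr_eq0 -lt0n.
  move=> _ /esym/eqP /=; rewrite mulf_eq0 invr_eq0 (negbTE aF) orbF pnatr_eq0.
  (* An empty expansion forces [w = 0], and coprimality then gives [a = 1]. *)
  move=> /eqP w0; move: cop; rewrite w0 /coprime gcdn0 => /eqP ->.
  exists 0; split=> [|y _]; last by split=> /=; ring.
  rewrite dedekind_sum_coprime // big_nil big_ord_recl big_ord0 /=.
  by rewrite mul0r; field.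
move=> /= /andP[k2 s2] e; have /andP[x0 x1] := negcf_ge0_lt1 s2.
have aF : a%:R != 0 :> rat by rewrite pnatr_eq0 -lt0n.
have k2F : 2 <= k%:R :> rat by rewrite ler_nat.
have w0 : (0 < w)%N.
  rewrite lt0n; apply: contra_eqN e => /eqP ->; rewrite mul0r.
  by rewrite invr_eq0 gt_eqF //; lra.
have wF : w%:R != 0 :> rat by rewrite pnatr_eq0 -lt0n.
have xE : negcf s = k%:R - a%:R / w%:R.
  by move/(congr1 GRing.inv): e; rewrite invrK invf_div => <-; ring.
have le_a : (a <= k * w)%N.
  by move: x0; rewrite xE subr_ge0 ler_pdivrMr ?ltr0n // -natrM ler_nat.
(* From [a / w = k - negcf s], the tail [s] expands [w2 / w]. *)
pose w2 := (k * w - a)%N.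
have w2E : w2%:R = k%:R * w%:R - a%:R :> rat by rewrite natrB // natrM.
have cop2 : coprime w w2.
  have d1 : (gcdn w w2 %| w2 + a)%N.
    by rewrite subnK // dvdn_mull // dvdn_gcdl.
  rewrite /coprime -dvdn1 -(eqP cop) dvdn_gcd dvdn_gcdl andbT.
  by rewrite -(dvdn_addr _ (dvdn_gcdr w w2)).
have [|w' [ded rec]] := IH w w2 w0 cop2 s2.
  by rewrite xE w2E; field.
(* The witness solves [w * x = 1 + a * w']. Reciprocity for [w] and [a], where [a] is [- w2] modulo
   [w], gives the Dedekind sums the matching recursion. *)
exists ((1 + a%:R * w') / w%:R); split.
  have := dedekind_reciprocity w0 a0; rewrite coprime_sym => /(_ cop).
  rewrite (@dedekind_sum_modl a (- w2%:Z) w) //; last first.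
    apply/eqP; rewrite eqz_mod_dvd opprK -PoszD addnC subnK //.
    exact: dvdn_mull.
  rewrite dedekind_sumN // => recip.
  rewrite big_cons -(addrK (\sum_(j <- s) (j%:R - 3)) (_ / a%:R + _)).
  have -> : dedekind_sum w a = - (1 / 4) + (w%:R / a%:R + a%:R / w%:R
      + (w%:R * a%:R)^-1) / 12 + dedekind_sum w2 w by rewrite -recip; ring.
  rewrite mulrDr ded w2E; field.
  by rewrite aF wF.
move=> y yrec.
have [|r1 r2] := rec (fun j => y j.+1); first by move=> j js;
  exact: (yrec j.+1).
have := yrec 0%N isT => /= y0.
have {}y0 : y 0%N = k%:R * y 1%N - y 2%N by rewrite -[LHS]subr0 -y0; ring.
have y2 : y 2%N = (w2%:R * y 1%N + y (size s).+2) / w%:R.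
  by rewrite -r1; field.
have aw : a%:R * y 1%N = w%:R * y 0%N + y (size s).+2.
  by rewrite y0 y2 w2E; field.
split=> //.
have -> : y (size s).+1 = (y 1%N + w' * y (size s).+2) / w%:R.
  by rewrite -r2; field.
have -> : y 0%N = (a%:R * y 1%N - y (size s).+2) / w%:R by rewrite aw; field.
by field.
Qed.

Lemma sum_ord_delta (V : nmodType) (n c : nat) (f : nat -> V) :
  \sum_(i < n) (if i == c :> nat then f i else 0) = if (c < n)%N then f c else
    0.
Proof.
rewrite -big_mkcond /=; case: ltnP => cn.
  by rewrite (big_pred1 (Ordinal cn)) // => i; rewrite -val_eqE.
by rewrite big_pred0 // => i; apply: contraTF cn => /eqP <-; rewrite -ltnNge.
Qed.

(** The adjunction equations absorb one of the two factors [Z] of the quadratic form, leaving an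
    expression linear in [Z]. *)
Lemma K2_plus_VE (V : finType) (E : V -> V -> int) (Z : V -> rat) :
  canonical_cycle E Z ->
  K2_plus_V E Z = \sum_v Z v * (E v v + 2)%:~R + #|V|%:R.
Proof.
move=> ZP; congr (_ + _); rewrite /cycle_dot exchange_big /=.
by apply: eq_bigr => v _; rewrite -(ZP v) mulr_sumr; apply: eq_bigr => u _;
  ring.
Qed.

(** * The canonical cycle of the star-shaped plumbing *)

Section StarPlumbing.
Variables (M : seifert) (legs : 'I_(nu M) -> seq nat).
Hypothesis legsP : HJ_legs legs.
Variable Z : star_vertex legs -> rat.

(* Position 0 on a leg is the centre; beyond the end of the leg [Z] is 0. *)
Definition leg_value (i : 'I_(nu M)) (j : nat) : rat :=
  (if j is j'.+1 then
     if insub j' : option 'I_(size (legs i)) is Some q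
     then Z (Some (Tagged (fun i => 'I_(size (legs i))) q)) else 0
   else Z None) - 1.

Lemma leg_value_ord (i : 'I_(nu M)) (q : 'I_(size (legs i))) :
  leg_value i q.+1 = Z (Some (Tagged (fun i => 'I_(size (legs i))) q)) - 1.
Proof. by rewrite /leg_value insubT ?ltn_ord // => h;
  congr (Z (Some (Tagged _ _)) - 1); apply: val_inj. Qed.

Lemma leg_value_end (i : 'I_(nu M)) (j : nat) :
  (size (legs i) <= j)%N -> leg_value i j.+1 = - 1.
Proof. by move=> h; rewrite /leg_value insubF ?ltnNge ?h // sub0r. Qed.

Lemma big_star (F : star_vertex legs -> rat) :
  \sum_x F x = F None + \sum_i \sum_(q < size (legs i))
     F (Some (Tagged (fun i => 'I_(size (legs i))) q)).
Proof.
rewrite big_option sig_big_dep; congr (_ + _).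
by apply: eq_bigr => -[i q].
Qed.

Hypothesis ZP : canonical_cycle (@star_form M legs) Z.

(** On a leg without curves position 1 has the default value -1, so that leg contributes 0. *)
Lemma star_central :
  Z None * (seif_b M)%:~R + \sum_i (leg_value i 1 + 1) = (seif_b M + 2)%:~R.
Proof.
rewrite -(ZP None) big_star /=; congr (_ + _).
apply: eq_bigr => i _.
under eq_bigr => q _.
  rewrite (_ : _ * _ = if q == 0 :> nat then leg_value i q.+1 + 1 else 0).
    by over.
  by rewrite leg_value_ord subrK; case: eqP => _; rewrite ?mulr1 ?mulr0.
rewrite (sum_ord_delta _ 0 (fun j => leg_value i j.+1 + 1)).
by case: ltnP => // /leg_value_end ->; rewrite addNr.
Qed.

(** For a curve of self-intersection [- k], adjunction has right-hand side [2 - k]; subtracting 1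
    from all multiplicities makes it homogeneous, at the centre and the end of the leg too. *)
Lemma star_leg (i : 'I_(nu M)) (j : nat) : (j < size (legs i))%N ->
  leg_value i j - (nth 0%N (legs i) j)%:R * leg_value i j.+1
    + leg_value i j.+2 = 0.
Proof.
move=> js; pose q := Ordinal js.
have := ZP (Some (Tagged (fun i => 'I_(size (legs i))) q)).
rewrite big_star (bigD1 i) //= [X in _ + (_ + X) = _]big1 ?addr0; last first.
  move=> i' ne; apply: big1 => q' _.
  by rewrite /= (negbTE ne) mulr0.
rewrite !eqxx /=.
set k : rat := (nth 0%N (legs i) j)%:R.
have -> : \sum_(q' < size (legs i))
      Z (Some (Tagged (fun i => 'I_(size (legs i))) q')) *
      (if q' == j :> nat then - (nth 0%N (legs i) q')%:Z
       else if (q' == j.+1 :> nat) || (j == q'.+1) then 1 else 0)%:~R =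
  - k * (leg_value i j.+1 + 1) + (leg_value i j.+2 + 1)
  + (if j == 0%N then 0 else leg_value i j + 1).
  (* The curve itself, its successor and its predecessor give three one-point sums. At [j = 0] the
     predecessor is the centre, outside this sum, while [j.-1 = j]; hence the inner conditional. *)
  rewrite (eq_bigr (fun q' : 'I_(size (legs i)) =>
      (if q' == j :> nat then - (nth 0%N (legs i) q')%:R
          * (leg_value i q'.+1 + 1) else 0)
      + (if q' == j.+1 :> nat then leg_value i q'.+1 + 1 else 0)
      + (if q' == j.-1 :> nat then
           if j == 0%N then 0 else leg_value i q'.+1 + 1 else 0))).
    rewrite !big_split /= (sum_ord_delta _ j (fun j => - (nth 0%N (legs i) j)%:R
          * (leg_value i j.+1 + 1))) js.
    rewrite (sum_ord_delta _ j.+1 (fun j => leg_value i j.+1 + 1)).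
    rewrite (sum_ord_delta _ j.-1 (fun j' => if j == 0%N then 0
       else leg_value i j'.+1 + 1)).
    rewrite (leq_ltn_trans (leq_pred j) js); congr (_ + _ + _).
      by case: ltnP => // /leg_value_end ->; rewrite addNr.
    by case: (j).
  move=> q' _; rewrite leg_value_ord subrK.
  set z := Z _; case: (eqVneq (q' : nat) j) => [->|ne].
    rewrite (_ : (j == j.+1) = false); last by lia.
    case: (eqVneq j j.-1) => [|_]; last by rewrite intrN; ring.
    by case: (j) => [|m] h; [rewrite intrN /=; ring|lia].
  case: (eqVneq (q' : nat) j.+1) => [->|ne'] /=.
    by rewrite (_ : (j.+1 == j.-1) = false) ?mulr1; [ring|lia].
  case: (eqVneq j 0%N) => [->|j0]; first by rewrite if_same; ring.
  rewrite (_ : (q' == j.-1 :> nat) = (j == q'.+1)); last by lia.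
  by case: eqP => _; ring.
rewrite intrD intrN -[_%:~R in X in _ = X + _ -> _]/k => /eqP.
rewrite -subr_eq0 => /eqP <-.
have -> : leg_value i j = if j == 0%N then Z None - 1 else leg_value i j.
  by case: (j).
by move: k; case: eqP => _ k; ring.
Qed.

(** The leg recurrences express the first and last values of each leg through the central value
    [y0]; the central equation becomes [euler M * y0 = X]. *)
Lemma star_K2 : euler M != 0 ->
  let X := 2 - (nu M)%:R + \sum_(i < nu M) (alpha i)%:R^-1 in
  K2_plus_V (@star_form M legs) Z =
    X ^+ 2 / euler M + euler M + 5
    + 12 * \sum_(i < nu M) dedekind_sum (beta i) (alpha i).
Proof.
move=> e0 X.
pose y0 := Z None - 1; pose a (i : 'I_(nu M)) : rat := (alpha i)%:R.
pose w (i : 'I_(nu M)) : rat := (omega i)%:~R.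
have aF (i : 'I_(nu M)) : a i != 0 by rewrite pnatr_eq0 -lt0n alpha_gt0.
have leg (i : 'I_(nu M)) : leg_value i 1 = (w i * y0 - 1) / a i /\
    leg_value i (size (legs i)) - \sum_(k <- legs i) (k%:R - 3) - 12 *
      dedekind_sum (beta i) (alpha i)
    = (y0 + w i) / a i.
  have [s2 sE] := legsP i.
  have a0 := alpha_gt0 i.
  have w0 : 0 <= omega i by rewrite modz_ge0 // gt_eqF.
  have wE : omega i = (absz (omega i)) :> int by rewrite gez0_abs.
  have cop : coprime (alpha i) `|omega i|.
    move: (alpha_beta_coprime i); rewrite -coprimezN /coprimez -gcdz_modr.
    by rewrite -/(omega i) wE /gcdz /coprime.
  have [|w' [ded rec]] := leg_recurrence a0 cop s2; first by rewrite sE wE.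
  have [r1 r2] := rec (leg_value i) (star_leg (i := i)).
  rewrite (leg_value_end (leqnn _)) in r1 r2.
  split; first by rewrite /w wE; apply: (mulfI (aF i));
    rewrite r1 [RHS]mulrC divfK.
  have -> : dedekind_sum (beta i) (alpha i) = - dedekind_sum `|omega i|%N
    (alpha i).
    rewrite -dedekind_sumN //; apply: dedekind_sum_modl => //.
    rewrite -wE /omega; apply/eqP; rewrite eqz_mod_dvd opprK addrC.
    by apply/dvdz_mod0P; rewrite modzDml addNr mod0z.
  have -> : leg_value i (size (legs i)) = (y0 - w') / a i.
    by apply: (mulfI (aF i)); rewrite r2 mulrN1 [RHS]mulrC divfK.
  have -> : w i = `|omega i|%N%:R by rewrite /w {1}wE.
  by rewrite mulrN ded /a; field; rewrite aF.
have central : euler M * y0 = X.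
  have := star_central.
  rewrite eulerE /X mulrDl mulr_suml => c.
  have -> : 2 = Z None * (seif_b M)%:~R + (\sum_i (leg_value i 1 + 1)) -
    (seif_b M)%:~R.
    by rewrite c intrD; ring.
  under [in RHS]eq_bigr => i _ do rewrite (leg i).1 mulrBl mul1r.
  rewrite big_split sumrB /= sumr_const card_ord.
  under [X in _ = _ + _ + X]eq_bigr => i _ do rewrite -[_^-1]/((a i)^-1).
  under eq_bigr => i _ do rewrite mulrAC.
  by rewrite /y0; ring.
have card : (#|star_vertex legs|)%:R = 1 + \sum_(i < nu M) (size (legs i))%:R
  :> rat.
  rewrite -sum1_card natr_sum big_star; congr (_ + _); apply: eq_bigr => i _.
  by rewrite sumr_const card_ord.
rewrite (K2_plus_VE ZP) card big_star.
under eq_bigr => i _.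
  rewrite (_ : \sum_(q < _) _ = leg_value i 1 + leg_value i (size (legs i)) -
    y0 + 1
     - \sum_(k <- legs i) (k%:R - 2)).
    over.
  have tele : \sum_(q < size (legs i)) (2 - (nth 0%N (legs i) q)%:R) *
    leg_value i q.+1
    = leg_value i 1 + leg_value i (size (legs i)) - y0 + 1.
    (* By the recurrence each summand is minus a second difference of [leg_value i], so only the
       ends of the leg survive. *)
    rewrite (eq_bigr (fun q : 'I_(size (legs i)) =>
      (leg_value i q.+1 - leg_value i q)
       - (leg_value i q.+2 - leg_value i q.+1))); last first.
      by move=> q _; have := star_leg (ltn_ord q); lra.
    rewrite sumrB -!(big_mkord xpredT (fun q =>
      leg_value i q.+1 - leg_value i q)).
    rewrite -!(big_mkord xpredT (fun q => leg_value i q.+2 - leg_value i q.+1)).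
    rewrite telescope_sumr // (telescope_sumr (fun q => leg_value i q.+1)) //.
    by rewrite leg_value_end // /y0 {2}/leg_value; ring.
  rewrite -tele (big_nth 0%N) big_mkord -sumrB; apply: eq_bigr => q _.
  rewrite leg_value_ord /= !eqxx /= intrD intrN.
  by rewrite -[(_ : int)%:~R in LHS]/((nth 0%N (legs i) q)%:R); ring.
rewrite /= -addrA [X in _ + X]addrCA -big_split /=.
rewrite (eq_bigr (fun i => w i / a i * (y0 + 1) + (a i)^-1 * (y0 - 1) - (y0 - 1)
   + 12 * dedekind_sum (beta i) (alpha i))); last first.
  move=> i _.
  have -> : leg_value i (size (legs i)) = (y0 + w i) / a i
    + \sum_(k <- legs i) (k%:R - 3) + 12 * dedekind_sum (beta i) (alpha i).
    by rewrite -(leg i).2; ring.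
  rewrite (leg i).1.
  have -> : \sum_(k <- legs i) (k%:R - 2) = \sum_(k <- legs i) (k%:R - 3) +
    (size (legs i))%:R :> rat.
    rewrite -sum1_size natr_sum -big_split /=; apply: eq_bigr => k _; ring.
  by field; rewrite aF.
rewrite !big_split /= -!mulr_suml -mulr_sumr sumr_const card_ord.
have -> : \sum_i (w i / a i) = euler M - (seif_b M)%:~R by rewrite eulerE
  addrC addKr.
have -> : Z None = y0 + 1 by rewrite subrK.
have -> : \sum_i (a i)^-1 = X - 2 + (nu M)%:R by rewrite /X; ring.
rewrite intrD -mulr_natl; have -> : y0 = X / euler M by rewrite -central mulrC
  mulKf.
by field.
Qed.

End StarPlumbing.

(** Adjunction at the exceptional curve fixes its coefficient; once this is substituted, both sides
    of the equation at a strict transform drop by 1 exactly on [S]. *)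
Lemma canonical_cycle_blowup (V : finType) (E : V -> V -> int) (S : {set V})
    (Z : option V -> rat) :
  canonical_cycle (blowup E S) Z <->
  Z None = \sum_(u in S) Z (Some u) - 1 /\ canonical_cycle E (Z \o Some).
Proof.
have sumS : \sum_u Z (Some u) * (u \in S)%:R = \sum_(u in S) Z (Some u).
  rewrite [RHS]big_mkcond; apply: eq_bigr => u _.
  by case: (u \in S); rewrite ?mulr1 ?mulr0.
have exc : \sum_u Z u * (blowup E S u None)%:~R
    = \sum_(u in S) Z (Some u) - Z None.
  rewrite big_option /= -sumS addrC mulrN1; congr (_ - _).
  by apply: eq_bigr => u _; case: (u \in S).
have strict v : Z None = \sum_(u in S) Z (Some u) - 1 ->
    \sum_u Z u * (blowup E S u (Some v))%:~R
    = \sum_u (Z \o Some) u * (E u v)%:~R - (v \in S)%:R.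
  move=> Z0; rewrite big_option /= Z0 -sumS.
  under [X in _ + X]eq_bigr => u _ do rewrite intrB intrM mulrBr mulrA.
  rewrite sumrB -mulr_suml.
  have -> : \sum_u Z (Some u) * ((u \in S)%:R : int)%:~R
      = \sum_u Z (Some u) * (u \in S)%:R.
    by apply: eq_bigr => u _; case: (u \in S).
  have -> : ((v \in S)%:R : int)%:~R = (v \in S)%:R :> rat by case: (v \in S).
  by ring.
have diag v : (blowup E S (Some v) (Some v) + 2)%:~R
    = (E v v + 2)%:~R - (v \in S)%:R :> rat.
  by rewrite /= addrAC intrB; case: (v \in S).
split=> [ZP|[Z0 ZP] [v|]].
- have Z0 : Z None = \sum_(u in S) Z (Some u) - 1.
    by have := ZP None; rewrite exc /= => e;
      rewrite -[RHS]/(_ - (-1 + 2)%:~R) -e; ring.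
  by split=> // v; have := ZP (Some v); rewrite strict // diag => /addIr.
- by rewrite strict // diag ZP.
- by rewrite exc Z0 /=; ring.
Qed.

(** The self-intersection of the cycle falls by 1 while the number of components grows by 1. *)
Lemma K2_plus_V_blowup (V : finType) (E : V -> V -> int) (S : {set V})
    (Z : option V -> rat) :
  canonical_cycle (blowup E S) Z ->
  K2_plus_V (blowup E S) Z = K2_plus_V E (Z \o Some).
Proof.
move=> ZP; have /canonical_cycle_blowup[Z0 ZP'] := ZP.
rewrite !K2_plus_VE // card_option big_option /= Z0 -natr1.
rewrite [X in _ + X + _ = _](eq_bigr (fun u => (Z \o Some) u * (E u u + 2)%:~R
    - (if u \in S then Z (Some u) else 0))); last first.
  by move=> u _; rewrite /= addrAC intrB; case: (u \in S) => /=; ring.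
by rewrite sumrB -big_mkcond /=; ring.
Qed.

Lemma resolution_K2 (M : seifert) (V : finType) (E : V -> V -> int)
    (Z : V -> rat) :
  euler M != 0 -> resolution M E -> canonical_cycle E Z ->
  K2_plus_V E Z =
    (2 - (nu M)%:R + \sum_(i < nu M) (alpha i)%:R^-1) ^+ 2 / euler M
    + euler M + 5 + 12 * \sum_(i < nu M) dedekind_sum (beta i) (alpha i).
Proof.
move=> e0 res; elim: V E / res Z => [legs legsP|V W E F f bij_f FE _ IH|
    V E S _ _ IH|V E S _ _ IH] Z ZP.
- exact: star_K2.
- rewrite -(IH (Z \o f)); last first.
    move=> v; rewrite -FE -ZP (reindex f) /=; last exact: onW_bij.
    by apply: eq_bigr => u _; rewrite FE.
  rewrite !K2_plus_VE ?(bij_eq_card bij_f) //; last first.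
    move=> v; rewrite -FE -ZP (reindex f) /=; last exact: onW_bij.
    by apply: eq_bigr => u _; rewrite FE.
  rewrite (reindex f) /=; last exact: onW_bij.
  by congr (_ + _); apply: eq_bigr => u _; rewrite FE.
- by rewrite K2_plus_V_blowup // IH //; case/canonical_cycle_blowup: ZP.
(* For a blow-down the cycle is extended by the only exceptional coefficient that adjunction
   allows. *)
- pose Z' x := if x is Some v then Z v else \sum_(u in S) Z u - 1.
  have Z'P : canonical_cycle (blowup E S) Z' by apply/canonical_cycle_blowup.
  by rewrite -(IH _ Z'P) K2_plus_V_blowup.
Qed.

(** * Limits at a double pole *)

Lemma cvg_horner_dnbhs (K : numFieldType) (q : {poly K}) (a : K) :
  (fun t : K^o => q.[t] : K^o) @ (a : K^o)^' --> (q.[a] : K^o).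
Proof.
elim/poly_ind: q => [|q c IH].
  by under eq_fun do rewrite horner0; rewrite horner0; exact: cvg_cst.
under eq_fun do rewrite hornerMXaddC; rewrite hornerMXaddC.
apply: cvgD; last exact: cvg_cst.
by apply: cvgM; [exact: IH|exact: nbhs_dnbhs].
Qed.

Lemma near1_expr_sub1 (K : numFieldType) (N : nat) : (0 < N)%N ->
  exists W : {poly K}, [/\ forall t, t ^+ N - 1 = (t - 1) * W.[t],
    W.[1] = N%:R & \forall t \near (1 : K^o)^', t != 1 /\ W.[t] != 0].
Proof.
move=> N0; pose W : {poly K} := \sum_(k < N) 'X^k; exists W.
have W1 : W.[1] = N%:R.
  rewrite horner_sum (eq_bigr (fun=> 1)) => [|k _]; last first.
    by rewrite hornerXn expr1n.
  by rewrite sumr_const card_ord.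
split=> // [t|].
  rewrite subrX1 horner_sum; congr (_ * _).
  by apply: eq_bigr => k _; rewrite hornerXn.
near=> t; split; near: t; first by exact: nbhs_dnbhs_neq.
have := @cvg_horner_dnbhs K W 1; rewrite W1 => /cvgr_neq0; apply.
by rewrite pnatr_eq0 -lt0n.
Unshelve. all: by end_near.
Qed.

(** Up to the factor [W ^+ 2], nonzero near 1, the denominator is [(t - 1) ^+ 2]. Finiteness of the
    limit lets two factors ['X - 1] be extracted from [p], and the cofactor at 1 is half the second
    derivative. *)
Lemma double_pole_limit (K : numFieldType) (p : {poly K}) (N : nat) (L : K) :
  (0 < N)%N ->
  (fun t : K^o => p.[t] / (t ^+ N - 1) ^+ 2 : K^o) @ (1 : K^o)^'
    --> (L : K^o) ->
  [/\ p.[1] = 0, p^`().[1] = 0 & p^`()^`().[1] = 2 * N%:R ^+ 2 * L].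
Proof.
move=> N0 pL.
have lim_uniq (f : K^o -> K^o) (x y : K) :
    f @ (1 : K^o)^' --> (x : K^o) -> f @ (1 : K^o)^' --> (y : K^o) -> x = y.
  by move=> fx fy; exact: (@norm_cvg_unique _ K^o _ _ _ _ fx fy).
have [W [WE W1 nearW]] := near1_expr_sub1 K N0.
have XB t : ('X - 1 : {poly K}).[t] = t - 1 by rewrite !hornerE.
have quot (q : {poly K}) k : p = q * ('X - 1) ^+ k ->
    (fun t : K^o => q.[t] * (t - 1) ^+ k / (t - 1) ^+ 2 : K^o) @ (1 : K^o)^'
      --> (N%:R ^+ 2 * L : K^o).
  move=> pE.
  have : (fun t : K^o => W.[t] * W.[t] * (p.[t] / (t ^+ N - 1) ^+ 2) : K^o)
      @ (1 : K^o)^' --> (W.[1] * W.[1] * L : K^o).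
    by apply: cvgM pL; apply: cvgM; exact: cvg_horner_dnbhs.
  rewrite W1 -expr2; apply: cvg_trans; apply: near_eq_cvg.
  near=> t.
  have [t1 Wt] : t != 1 /\ W.[t] != 0 by near: t.
  have t1' : t - 1 != 0 by rewrite subr_eq0.
  rewrite pE WE hornerM horner_exp XB.
  have cancel (w x u s : K) : w != 0 -> u != 0 ->
      w * w * (x * s / (u * w) ^+ 2) = x * s / u ^+ 2.
    by move=> w0 u0; field; rewrite w0 u0.
  exact: cancel.
(* Multiplying the finite limit by the missing positive power of [t - 1] gives 0, while the function
   becomes [q]. *)
have root_next (q : {poly K}) k : p = q * ('X - 1) ^+ k -> (k < 2)%N ->
    q.[1] = 0.
  move=> pE k2; apply: (lim_uniq (fun t => q.[t]));
    first exact: cvg_horner_dnbhs.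
  have : (fun t : K^o => (('X - 1) ^+ (2 - k)).[t]
        * (q.[t] * (t - 1) ^+ k / (t - 1) ^+ 2) : K^o)
      @ (1 : K^o)^' --> ((('X - 1) ^+ (2 - k)).[1] * (N%:R ^+ 2 * L) : K^o).
    by apply: cvgM (quot q k pE); exact: cvg_horner_dnbhs.
  rewrite horner_exp XB subrr expr0n subn_eq0 leqNgt k2 mul0r.
  apply: cvg_trans; apply: near_eq_cvg; near=> t.
  have [t1 _] : t != 1 /\ W.[t] != 0 by near: t.
  have t1' : (t - 1) ^+ 2 != 0 by rewrite expf_neq0 // subr_eq0.
  rewrite horner_exp XB mulrA [_ * (q.[t] * _)]mulrCA -exprD subnK ?mulfK //.
  exact: ltnW.
have p1 : p.[1] = 0 by apply: (root_next p 0%N) => //; rewrite expr0 mulr1.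
have /factor_theorem[q pq] : root p 1 by apply/eqP.
have q1 : q.[1] = 0 by apply: (root_next q 1%N) => //; rewrite expr1 pq polyC1.
have /factor_theorem[r qr] : root q 1 by apply/eqP.
have pr : p = r * ('X - 1) ^+ 2 by rewrite pq qr polyC1 -mulrA expr2.
have r1 : r.[1] = N%:R ^+ 2 * L.
  apply: (lim_uniq (fun t => r.[t])); first exact: cvg_horner_dnbhs.
  apply: cvg_trans (quot r 2%N pr); apply: near_eq_cvg; near=> t.
  have [t1 _] : t != 1 /\ W.[t] != 0 by near: t.
  by rewrite mulfK // expf_neq0 // subr_eq0.
have d1 : p^`() = r^`() * ('X - 1) ^+ 2 + r * ('X - 1) *+ 2.
  rewrite pr -polyC1 expr2 !derivM !derivXsubC.
  by ring.
split=> //; first by rewrite d1 hornerD hornerMn !hornerM XB subrr; ring.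
rewrite -mulrA -r1 d1 -polyC1 expr2 !(derivXsubC, derivM, derivMn, derivD).
rewrite !(hornerXsubC, hornerM, hornerMn, hornerC, hornerD) subrr.
by ring.
Unshelve. all: by end_near.
Qed.

(** * Characters *)

Lemma prim_root_exists (K : numClosedFieldType) (n : nat) : (0 < n)%N ->
  exists z : K, n.-primitive_root z.
Proof.
move=> n0; have [r Dp] := closed_field_poly_normal ('X^n - 1 : {poly K}).
rewrite (monicP _) ?monicXnsubC // scale1r in Dp.
have rn1 : all n.-unity_root r by apply/allP => z; rewrite -root_prod_XsubC -Dp.
have sz_r : (n < (size r).+1)%N.
  by rewrite -(size_prod_XsubC r id) -Dp size_XnsubC.
have [|z] := hasP (has_prim_root n0 rn1 _ sz_r); last by exists z.
by rewrite -separable_prod_XsubC -Dp separable_Xn_sub_1 // pnatr_eq0 -lt0n.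
Qed.

(** The derived subgroup is trivial, so linear characters over the algebraic numbers separate
    points. Only exponents of a root of unity are kept, which makes the character transferable to
    another field. *)
Lemma separating_exponents (H : finZmodType) (m : nat) (h : H) :
  #|H| = m.+1 -> h != 0 ->
  exists2 k : H -> 'I_m.+1, {morph k : x y / x + y} & k h != 0.
Proof.
move=> cardH h0; pose G := [set: H]%G.
have [w wP] := C_prim_root_exists (ltn0Sn m).
have der0 : (G^`(1) = 1)%g by apply/commG1P; exact: FinRing.zmod_abelian.
have : h \notin (G^`(1))%g by rewrite der0 inE.
rewrite -cap_cfker_lin_irr => /bigcapP hker.
have [i lin_i nker] : exists2 i : Iirr G,
    'chi_i \is a linear_char & h \notin cfker 'chi_i.
  apply: contrapT => no; apply: hker => i lin_i; apply: contrapT => /negP nk.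
  by apply: no; exists i.
have chi1 x : 'chi_i x ^+ m.+1 = 1.
  rewrite -cardH -cardsT -lin_charX ?inE // [(x ^+ _)%g]expg_cardG ?inE //.
  exact: lin_char1.
pose k x : 'I_m.+1 := sval (prim_rootP wP (chi1 x)).
have kE x : 'chi_i x = w ^+ k x by rewrite /k; case: prim_rootP.
exists k.
  move=> x y; apply/val_inj/eqP => /=.
  rewrite -[X in X == _](modn_small (ltn_ord _)) -(eq_prim_root_expr wP) exprD.
  by rewrite -!kE -[x + y]/(x * y)%g lin_charM ?inE.
apply: contraNneq nker => k0; rewrite cfkerEirr inE kE k0 expr0.
by rewrite lin_char1.
Qed.

(** Characters are encoded by additive maps to the integers modulo [#|H|], composed with powers of a
    primitive root of unity; these maps form a finite type. *)
Lemma dual_family (K : numClosedFieldType) (H : finZmodType) :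
  exists (X : finType) (chi : X -> H -> K) (x0 : X),
    [/\ forall x, (forall h, `|chi x h| = 1) /\
          (forall h h', chi x (h + h') = chi x h * chi x h'),
        forall h, chi x0 h = 1,
        forall x, x != x0 -> exists h, chi x h != 1 &
        forall h, \sum_x chi x h = if h == 0 then #|X|%:R else 0].
Proof.
have [m cardH] : exists m, #|H| = m.+1.
  by exists #|H|.-1; rewrite prednK //; apply/card_gt0P; exists 0.
have [z zP] := prim_root_exists K (ltn0Sn m).
pose additive (k : {ffun H -> 'I_m.+1}) := [forall x, forall y,
  k (x + y) == k x + k y].
pose X := {k : {ffun H -> 'I_m.+1} | additive k}.
have morph (k : X) x y : val k (x + y) = val k x + val k y.
  exact: (eqP (forallP (forallP (valP k) x) y)).
pose chi (k : X) h := z ^+ val k h.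
have zD (i j : 'I_m.+1) : z ^+ (i + j)%R = z ^+ i * z ^+ j.
  by rewrite /= prim_expr_mod // exprD.
have add0 : additive [ffun=> 0].
  by apply/forallP => x; apply/forallP => y; rewrite !ffunE addr0.
have addD (k l : X) : additive [ffun x => val k x + val l x].
  by apply/forallP => x; apply/forallP => y; rewrite !ffunE !morph addrACA.
pose shift k l : X := Sub _ (addD k l).
have shift_inj k : injective (shift k).
  move=> l l' /(congr1 val)/ffunP e; apply/val_inj/ffunP => x.
  by have := e x; rewrite !ffunE => /addrI.
exists X, chi, (Sub _ add0); split.
- move=> k; split=> [h|h h']; last by rewrite /chi morph zD.
  have /eqP zn : `|z| == 1.
    by rewrite -(@pexpr_eq1 _ _ m.+1) // -normrX prim_expr_order // normr1.
  by rewrite normrX zn expr1n.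
- by move=> h; rewrite /chi /= ffunE expr0.
- move=> k; apply: contraNP => triv; apply/eqP/val_inj/ffunP => h.
  rewrite /= ffunE; apply/val_inj/eqP => /=; apply: contrapT => kh; apply: triv.
  exists h; apply/negP; rewrite /chi -(expr0 z) (eq_prim_root_expr zP).
  by rewrite mod0n modn_small.
move=> h; case: (eqVneq h 0) => [->|h0].
  rewrite (eq_bigr (fun=> 1)) ?sumr_const // => k _.
  have : val k 0 = 0 by apply: (addrI (val k 0)); rewrite -morph !addr0.
  by rewrite /chi => ->; rewrite expr0.
have [k kD kh] := separating_exponents cardH h0.
have addk : additive (finfun k).
  by apply/forallP => x; apply/forallP => y; rewrite !ffunE kD.
pose k' : X := Sub _ addk.
have k'1 : chi k' h != 1.
  apply: contra kh; rewrite /chi /= ffunE -(expr0 z) (eq_prim_root_expr zP).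
  by rewrite mod0n modn_small.
(* Translation by a character nontrivial at [h] permutes the family, so the sum equals itself times
   a factor other than 1. *)
have : \sum_l chi l h = chi k' h * \sum_l chi l h.
  rewrite {1}(reindex_inj (shift_inj k')) mulr_sumr; apply: eq_bigr => l _.
  by rewrite /chi /= ffunE zD.
move/eqP; rewrite -subr_eq0 -{1}[\sum_l _]mul1r -mulrBl mulf_eq0 subr_eq0.
by rewrite eq_sym (negbTE k'1) => /eqP.
Qed.

(** * Torsion as a sum over words representing 0 *)

Lemma near1_expr_neq1 (K : numFieldType) (N : nat) : (0 < N)%N ->
  \forall t \near (1 : K^o)^', (t : K) ^+ N != 1.
Proof.
move=> N0; have [W [WE _ nearW]] := near1_expr_sub1 K N0.
near=> t; have [t1 Wt] : t != 1 /\ W.[t] != 0 by near: t.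
by rewrite -subr_eq0 WE mulf_neq0 // subr_eq0.
Unshelve. all: by end_near.
Qed.

(** * Generating polynomials and their moments *)

Definition geom_poly (K : nzRingType) (z : K) (a d : nat) : {poly K} :=
  \sum_(c < a) z ^+ c *: 'X^(c * d).

Lemma horner_geom_poly (K : comNzRingType) (z t : K) (a d : nat) :
  (t ^+ d * z - 1) * (geom_poly z a d).[t] = t ^+ (a * d) * z ^+ a - 1.
Proof.
rewrite mulnC exprM -exprMn subrX1 horner_sum; congr (_ * _).
apply: eq_bigr => c _; rewrite hornerZ hornerXn exprMn mulrC.
by rewrite -exprM mulnC.
Qed.

Lemma deriv_sum (K : nzRingType) (I : finType) (P : pred I) (F : I -> {poly
  K}) :
  (\sum_(i | P i) F i)^`() = \sum_(i | P i) (F i)^`().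
Proof. exact: raddf_sum. Qed.

(** Mean and variance of the exponent under the law generated by [p], multiplied by the total mass
    [p.[1]] to avoid a quotient. *)
Definition has_mean_var (K : fieldType) (p : {poly K}) (m v : K) : Prop :=
  p^`().[1] = m * p.[1] /\ p^`()^`().[1] + p^`().[1] = (v + m ^+ 2) * p.[1].

(** The exponents of a product add up as independent variables. *)
Lemma has_mean_varM (K : fieldType) (p q : {poly K}) (m v n w : K) :
  has_mean_var p m v -> has_mean_var q n w ->
  has_mean_var (p * q) (m + n) (v + w).
Proof.
move=> [p1 p2] [q1 q2].
have {}p2 : p^`()^`().[1] = (v + m ^+ 2) * p.[1] - m * p.[1] by rewrite -p1
  -p2 addrK.
have {}q2 : q^`()^`().[1] = (w + n ^+ 2) * q.[1] - n * q.[1] by rewrite -q1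
  -q2 addrK.
by split; rewrite !(derivM, derivD) !(hornerM, hornerD) ?p2 ?q2 p1 q1; ring.
Qed.

Lemma has_mean_var1 (K : fieldType) : has_mean_var (1 : {poly K}) 0 0.
Proof. by rewrite /has_mean_var -polyC1 !derivC !hornerC; split; ring. Qed.

Lemma has_mean_var_prod (K : fieldType) (I : finType) (p : I -> {poly K})
    (m v : I -> K) : (forall i, has_mean_var (p i) (m i) (v i)) ->
  has_mean_var (\prod_i p i) (\sum_i m i) (\sum_i v i).
Proof.
move=> h; elim/big_rec3: _ => [|i x y z _ xyz]; first exact: has_mean_var1.
exact: has_mean_varM.
Qed.

Lemma derivXn_at1 (K : comNzRingType) (k : nat) : ('X^k : {poly K})^`().[1] =
  k%:R.
Proof. by rewrite derivXn hornerMn hornerXn expr1n. Qed.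

Lemma deriv2Xn_at1 (K : comNzRingType) (k : nat) :
  ('X^k : {poly K})^`()^`().[1] = k%:R ^+ 2 - k%:R.
Proof.
rewrite derivXn derivMn derivXn !hornerMn hornerXn expr1n.
case: k => [|k]; first by rewrite mulr0n; ring.
by rewrite /= -natr1 -mulr_natr -natr1; ring.
Qed.

(** At [z = 1] this is the uniform law on the multiples of [d] from 0 to [(a - 1) * d]. *)
Lemma geom_poly_mean_var (K : numFieldType) (a d : nat) :
  (geom_poly (1 : K) a d).[1] = a%:R /\
  has_mean_var (geom_poly (1 : K) a d)
    (d%:R * (a%:R - 1) / 2) (d%:R ^+ 2 * (a%:R ^+ 2 - 1) / 12).
Proof.
have v0 : (geom_poly (1 : K) a d).[1] = a%:R.
  rewrite horner_sum (eq_bigr (fun=> 1)) ?sumr_const ?card_ord // => c _.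
  by rewrite hornerZ hornerXn !expr1n mulr1.
have v1 : (geom_poly (1 : K) a d)^`().[1] = d%:R * (a%:R * (a%:R - 1) / 2).
  rewrite -sumr_ord mulr_sumr deriv_sum horner_sum; apply: eq_bigr => c _.
  by rewrite derivZ hornerZ derivXn_at1 expr1n natrM; ring.
have v2 : (geom_poly (1 : K) a d)^`()^`().[1] + (geom_poly (1 : K) a
  d)^`().[1] =
    d%:R ^+ 2 * (a%:R * (a%:R - 1) * (2 * a%:R - 1) / 6).
  rewrite -sumr_ord_sqr mulr_sumr !deriv_sum !horner_sum -big_split.
  apply: eq_bigr => c _.
  by rewrite /= !derivZ !hornerZ derivXn_at1 deriv2Xn_at1 expr1n natrM; ring.
by split=> //; split; rewrite ?v2 v0 ?v1; field.
Qed.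

Lemma cvg_sum_dnbhs (K : numFieldType) (I : finType) (P : pred I)
    (f : I -> K^o -> K^o) (l : I -> K) (a : K) :
  (forall i, P i -> f i @ (a : K^o)^' --> (l i : K^o)) ->
  (fun t => \sum_(i | P i) f i t) @ (a : K^o)^' --> (\sum_(i | P i) l i : K^o).
Proof.
move=> fl.
have -> : (fun t => \sum_(i | P i) f i t) = \sum_(i | P i) f i.
  by apply/funext => t; rewrite fct_sumE.
apply: (big_rec2 (fun (F : K^o -> K^o) (L : K^o) => F @ (a : K^o)^' --> L)).
  exact: cvg_cst.
by move=> i x y Pi xy; apply: cvgD; [exact: fl|exact: xy].
Qed.

(** The second moment of the exponents of [p] about [a], written through the jet at 1: for a double
    zero there, only the second derivative remains. *)
Definition moment2 (K : nzRingType) (a : K) (p : {poly K}) : K :=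
  p^`()^`().[1] + (1 - a *+ 2) * p^`().[1] + a ^+ 2 * p.[1].

Lemma moment2_sum (K : nzRingType) (a : K) (I : finType) (P : pred I)
    (F : I -> {poly K}) :
  moment2 a (\sum_(i | P i) F i) = \sum_(i | P i) moment2 a (F i).
Proof.
by rewrite /moment2 !deriv_sum !horner_sum !mulr_sumr -!big_split.
Qed.

Lemma moment2_monomial (K : comNzRingType) (a c : K) (k : nat) :
  moment2 a (c *: 'X^k) = c * (k%:R - a) ^+ 2.
Proof.
by rewrite /moment2 !derivZ !hornerZ derivXn_at1 deriv2Xn_at1 hornerXn expr1n;
  ring.
Qed.

Lemma moment2_mean_var (K : fieldType) (p : {poly K}) (m v : K) :
  has_mean_var p m v -> moment2 m p = v * p.[1].
Proof.
move=> [p1 p2]; have -> : v * p.[1] = (v + m ^+ 2) * p.[1] - m ^+ 2 * p.[1] by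
  ring.
by rewrite -p2 /moment2 p1; ring.
Qed.

(** * The torsion polynomials of the characters *)

Section Torsion.
Variable M : seifert.
Local Notation p := (alpha_lcm M).

Lemma dvdn_alpha_lcm (i : 'I_(nu M)) : (alpha i %| p)%N.
Proof. exact: biglcmn_sup. Qed.

Lemma alpha_lcm_gt0 : (0 < p)%N.
Proof.
rewrite /alpha_lcm; elim/big_rec: _ => // i x _ x0.
by rewrite lcmn_gt0 alpha_gt0.
Qed.

Lemma leq_alpha_lcm (i : 'I_(nu M)) : (alpha i <= p)%N.
Proof. by rewrite dvdn_leq ?alpha_lcm_gt0 ?dvdn_alpha_lcm. Qed.

Lemma mul_alpha_lcm (i : 'I_(nu M)) : (alpha i * (p %/ alpha i) = p)%N.
Proof. by rewrite mulnC divnK // dvdn_alpha_lcm. Qed.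

(* [x] stands for the monomial [\prod_i g_i ^ x.1 i * g_0 ^ (x.2.1 + x.2.2)];
   the last two exponents come from the double pole [(1 - t ^ alpha g_0) ^ -2].
     *)
Definition expansion_index (n : nat) : finType :=
  ({ffun 'I_(nu M) -> 'I_p} * ('I_n * 'I_n))%type.

(** The common codomain ['I_p] of [x.1] avoids ranges depending on [i]; this predicate restores
    them. *)
Definition reduced (n : nat) (x : expansion_index n) : bool :=
  [forall i, x.1 i < alpha i]%N.

Definition expansion_degree (n : nat) (x : expansion_index n) : nat :=
  (\sum_i x.1 i * (p %/ alpha i) + (x.2.1 + x.2.2) * p)%N.

Definition expansion_elt (H : zmodType) (g : option 'I_(nu M) -> H) (n : nat)
    (x : expansion_index n) : H :=
  \sum_i g (Some i) *+ x.1 i + g None *+ (x.2.1 + x.2.2).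

Definition torsion_poly (K : numFieldType) (z : option 'I_(nu M) -> K) (n :
  nat) :
    {poly K} :=
  (\prod_i geom_poly (z (Some i)) (alpha i) (p %/ alpha i)) *
  (geom_poly (z None) n p * geom_poly (z None) n p).

(** Distributing the product picks one exponent per factor, and multiplicativity gathers the
    coefficients into a single character value. *)
Lemma torsion_polyE (K : numFieldType) (H : zmodType)
    (g : option 'I_(nu M) -> H) (chi : H -> K) (n : nat) :
  (forall h, `|chi h| = 1) -> {morph chi : h h' / h + h' >-> h * h'} ->
  torsion_poly (chi \o g) n =
  \sum_(x : expansion_index n | reduced x)
     chi (expansion_elt g x) *: 'X^(expansion_degree x).
Proof.
move=> chi1 chiD.
have chi0 : chi 0 = 1.
  have /mulfI : chi 0 != 0 by rewrite -normr_eq0 chi1 oner_eq0.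
  by apply; rewrite -chiD addr0 mulr1.
have chiX h k : chi (h *+ k) = chi h ^+ k.
  by elim: k => [|k IH]; rewrite ?mulr0n ?expr0 // mulrS exprS chiD IH.
have chi_sum (f : 'I_(nu M) -> H) : chi (\sum_i f i) = \prod_i chi (f i).
  exact: big_morph.
rewrite /torsion_poly.
have -> : \prod_i geom_poly (chi (g (Some i))) (alpha i) (p %/ alpha i) =
    \sum_(f : {ffun 'I_(nu M) -> 'I_p} | [forall i, f i < alpha i]%N)
      chi (\sum_i g (Some i) *+ f i) *: 'X^(\sum_i f i * (p %/ alpha i))%N.
  rewrite (eq_bigr (fun i => \sum_(c < p | (c < alpha i)%N)
      chi (g (Some i)) ^+ c *: 'X^(c * (p %/ alpha i)))); last first.
    move=> i _; rewrite /geom_poly.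
    exact: (big_ord_widen _ (fun c => chi (g (Some i)) ^+ c *: 'X^(c * (p %/
      alpha i)))
      (leq_alpha_lcm i)).
  rewrite bigA_distr_big_dep; apply: eq_big => [f|f _].
    by apply/familyP/forallP => h i; apply: h.
  rewrite scaler_prod chi_sum; congr (_ *: _).
    by apply: eq_bigr => i _; rewrite chiX.
  by rewrite (big_morph _ (exprD 'X) (expr0 'X)).
have -> : geom_poly (chi (g None)) n p * geom_poly (chi (g None)) n p =
    \sum_(l : 'I_n * 'I_n) chi (g None *+ (l.1 + l.2)) *: 'X^((l.1 + l.2) * p).
  rewrite /geom_poly big_distrlr /= pair_bigA; apply: eq_bigr => -[l l'] _ /=.
  by rewrite -scalerAl -scalerAr scalerA chiX mulnDl !exprD.
rewrite big_distrlr /= pair_big /=; apply: eq_big => [[f l]|[f l] _].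
  by rewrite andbT.
by rewrite -scalerAl -scalerAr scalerA -chiD -exprD.
Qed.

(** Geometric sums complete each denominator factor to the common value [u = t ^+ p * z None - 1],
    leaving [u ^+ 2] below the line; one more, squared, completes it to
    [(t ^+ (n * p) - 1) ^+ 2]. *)
Lemma torsion_factor (K : numFieldType) (z : option 'I_(nu M) -> K) (n : nat)
    (t : K) :
  z None ^+ n = 1 -> (forall i, z (Some i) ^+ alpha i = z None) ->
  t ^+ (n * p) != 1 ->
  (t ^+ p * z None - 1) ^+ (nu M - 2)
    / (\prod_(i < nu M) (t ^+ (p %/ alpha i) * z (Some i) - 1))
  = (torsion_poly z n).[t] / (t ^+ (n * p) - 1) ^+ 2.
Proof.
move=> zn za tN; set u := t ^+ p * z None - 1.
have uC : u * (geom_poly (z None) n p).[t] = t ^+ (n * p) - 1.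
  by rewrite horner_geom_poly zn mulr1.
have tN0 : t ^+ (n * p) - 1 != 0 by rewrite subr_eq0.
have u0 : u != 0 by apply: contraNneq tN0 => u0; rewrite -uC u0 mul0r.
have bB i : (t ^+ (p %/ alpha i) * z (Some i) - 1)
    * (geom_poly (z (Some i)) (alpha i) (p %/ alpha i)).[t] = u.
  by rewrite horner_geom_poly za mul_alpha_lcm.
have b0 i : t ^+ (p %/ alpha i) * z (Some i) - 1 != 0.
  by apply: contraNneq u0 => b0; rewrite -(bB i) b0 mul0r.
have C0 : (geom_poly (z None) n p).[t] != 0.
  by apply: contraNneq tN0 => C0; rewrite -uC C0 mulr0.
rewrite -uC /torsion_poly !hornerM horner_prod.
set C := _.[t] in C0 *.
have -> : \prod_i (geom_poly (z (Some i)) (alpha i) (p %/ alpha i)).[t] =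
    u ^+ nu M / \prod_(i < nu M) (t ^+ (p %/ alpha i) * z (Some i) - 1).
  rewrite -[in u ^+ _](card_ord (nu M)) -prodr_const -prodf_div.
  by apply: eq_bigr => i _; rewrite -(bB i) mulrC mulKf.
have -> : u ^+ nu M = u ^+ (nu M - 2) * u ^+ 2.
  by rewrite -exprD subnK //; have := nu_ge3 M; lia.
have : \prod_(i < nu M) (t ^+ (p %/ alpha i) * z (Some i) - 1) != 0.
  by apply/prodf_neq0 => i _.
move: (\prod_(i < _) _) (u ^+ (nu M - 2)) => D w D0.
by field; rewrite D0 C0 u0.
Qed.

(** The last term has no denominator 2 because the double pole contributes two uniform factors of
    mean [p * (n - 1) / 2]. *)
Definition degree_mean (n : nat) : rat :=
  \sum_(i < nu M) (p %/ alpha i)%:R * ((alpha i)%:R - 1) / 2 + p%:R * (n%:R -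
    1).

Definition degree_variance (n : nat) : rat :=
  \sum_(i < nu M) (p %/ alpha i)%:R ^+ 2 * ((alpha i)%:R ^+ 2 - 1) / 12
  + p%:R ^+ 2 * (n%:R ^+ 2 - 1) / 6.

Lemma torsion_poly1_mean_var (K : numFieldType) (z : option 'I_(nu M) -> K)
    (n : nat) : (forall i, z i = 1) ->
  has_mean_var (torsion_poly z n)
    (ratr (degree_mean n)) (ratr (degree_variance n)).
Proof.
move=> z1; rewrite /torsion_poly z1.
under eq_bigr do rewrite z1.
have hB := has_mean_var_prod (fun i : 'I_(nu M) =>
  (geom_poly_mean_var K (alpha i) (p %/ alpha i)).2).
have hC := (geom_poly_mean_var K n p).2.
have := has_mean_varM hB (has_mean_varM hC hC).
congr has_mean_var; rewrite /degree_mean /degree_variance.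
  rewrite rmorphD rmorph_sum /= rmorphM rmorphB rmorph1 !rmorph_nat.
  congr (_ + _); last by field.
  by apply: eq_bigr => i _; rewrite !rmorphM fmorphV rmorphB rmorph1
    !rmorph_nat.
rewrite rmorphD rmorph_sum /= !rmorphM fmorphV rmorphB rmorph1 !rmorphXn
  !rmorph_nat.
congr (_ + _); last by field.
apply: eq_bigr => i _.
by rewrite !rmorphM fmorphV rmorphB rmorph1 !rmorphXn !rmorph_nat.
Qed.

(* The jets at 1 of the torsion polynomials of the nontrivial characters are
   known, and averaging over all the characters keeps the exponents that
   represent 0; the trivial character is a product of uniform laws. *)
Lemma torsion_moment (R : realType) (H : finZmodType) (g : option 'I_(nu M) ->
  H)
    (T : H -> rat) (n : nat) :
  (0 < n)%N -> g None *+ n = 0 -> (forall i, g (Some i) *+ alpha i = g None) ->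
  is_torsion_can R g T ->
  2 * (n * p)%:R ^+ 2 * T 0 =
  \sum_(x : expansion_index n | reduced x && (expansion_elt g x == 0))
     (((expansion_degree x)%:R - degree_mean n) ^+ 2 - degree_variance n).
Proof.
move=> n0 gn ga [T0 TP]; pose K : numClosedFieldType := R[i].
have [X [chi [x0 [chiU chi0 chin chi_sum]]]] := dual_family K H.
have chiX x h k : chi x (h *+ k) = chi x h ^+ k.
  elim: k => [|k IH]; last by rewrite mulrS exprS (chiU x).2 IH.
  have /mulfI : chi x 0 != 0 by rewrite -normr_eq0 (chiU x).1 oner_eq0.
  by apply; rewrite -(chiU x).2 addr0 mulr1.
have chi_zero x : chi x 0 = 1 by have := chiX x 0 0%N; rewrite mulr0n expr0.
pose G x := torsion_poly (chi x \o g) n.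
pose That x : K := \sum_h ratr (T h) * chi x h.
have N0 : (0 < n * p)%N by rewrite muln_gt0 n0 alpha_lcm_gt0.
have lim x : x != x0 ->
    (fun t : K^o => (G x).[t] / (t ^+ (n * p) - 1) ^+ 2 : K^o) @ (1 : K^o)^'
      --> (That x : K^o).
  move=> xx0; apply: cvg_trans (TP (chi x) (chiU x) (chin x xx0)).
  apply: near_eq_cvg; near=> t.
  rewrite (torsion_factor (z := chi x \o g) (n := n)) //=.
  - by rewrite -chiX gn chi_zero.
  - by move=> i; rewrite -chiX ga.
  - by near: t; exact: near1_expr_neq1.
pose P := \sum_(x | x != x0) G x.
have limP : (fun t : K^o => P.[t] / (t ^+ (n * p) - 1) ^+ 2 : K^o) @ (1 : K^o)^'
      --> (\sum_(x | x != x0) That x : K^o).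
  under eq_fun do rewrite horner_sum mulr_suml.
  exact: cvg_sum_dnbhs.
(* The coefficients of [T] sum to 0, so the trivial character may be included before Fourier
   inversion. *)
have ThatE : \sum_(x | x != x0) That x = #|X|%:R * ratr (T 0).
  have That0 : That x0 = 0.
    rewrite -(rmorph0 (ratr : rat -> K)) -T0 rmorph_sum.
    by apply: eq_bigr => h _; rewrite chi0 mulr1.
  have -> : \sum_(x | x != x0) That x = \sum_x That x.
    by rewrite [RHS](bigD1 x0) //= That0 add0r.
  rewrite exchange_big (bigD1 0) //= -mulr_sumr chi_sum eqxx mulrC.
  by rewrite big1 ?addr0 // => h h0; rewrite -mulr_sumr chi_sum (negbTE h0)
    mulr0.
have [P1 P2 P3] := double_pole_limit N0 limP.
(* As [P] and its derivative vanish at 1, the centre [a] is free; it will be the mean of the trivial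
   law. *)
have momP a : moment2 a P = 2 * (n * p)%:R ^+ 2 * (#|X|%:R * ratr (T 0)).
  by rewrite /moment2 P1 P2 P3 ThatE !mulr0 !addr0.
pose S := [pred x : expansion_index n | reduced x && (expansion_elt g x == 0)].
have sumG : \sum_x G x = #|X|%:R *: \sum_(x in S) 'X^(expansion_degree x).
  rewrite (eq_bigr _ (fun x _ => torsion_polyE g n (chiU x).1 (chiU x).2)).
  rewrite exchange_big /= [\sum_(x in S) _]big_mkcondr /= scaler_sumr.
  apply: eq_bigr => x _; rewrite -scaler_suml chi_sum.
  by case: eqP; rewrite ?scale0r ?scaler0.
have PE : P = \sum_x G x - G x0 by rewrite (bigD1 x0) //= addrAC subrr add0r.
have triv := torsion_poly1_mean_var (z := chi x0 \o g) n (fun i => chi0 (g i)).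
(* Vanishing of [P] at 1 equates the mass of the trivial term with [#|X|] times the number of words
   in [S], so its variance is shared out one copy per word. *)
have G1 : (G x0).[1] = #|X|%:R * \sum_(x in S) 1.
  move: P1; rewrite PE hornerD hornerN => /eqP; rewrite subr_eq0 => /eqP <-.
  rewrite sumG hornerZ horner_sum; congr (_ * _).
  by apply: eq_bigr => x _; rewrite hornerXn expr1n.
have := momP (ratr (degree_mean n)).
have -> : moment2 (ratr (degree_mean n)) P =
    #|X|%:R * ratr (\sum_(x in S)
      (((expansion_degree x)%:R - degree_mean n) ^+ 2 - degree_variance n)).
  have -> : P = \sum_x G x + (- 1) *: G x0 by rewrite PE scaleN1r.
  have momZD a c (q r : {poly K}) : moment2 a (q + c *: r) = moment2 a q + c *
    moment2 a r.
    by rewrite /moment2 !derivD !derivZ !hornerD !hornerZ; ring.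
  rewrite momZD (moment2_mean_var triv) G1 sumG.
  have momZ a c (q : {poly K}) : moment2 a (c *: q) = c * moment2 a q.
    by rewrite /moment2 !derivZ !hornerZ; ring.
  rewrite momZ moment2_sum rmorph_sum /=.
  rewrite [X in _ = _ * X](eq_bigr (fun x : expansion_index n =>
    moment2 (ratr (degree_mean n)) ('X^(expansion_degree x) : {poly K})
    - ratr (degree_variance n) * 1)).
    by rewrite sumrB -mulr_sumr; ring.
  move=> x _; rewrite -[X in moment2 _ X]scale1r moment2_monomial.
  by rewrite rmorphB rmorphXn rmorphB rmorph_nat; ring.
have XK : #|X|%:R != 0 :> K by rewrite pnatr_eq0 -lt0n; apply/card_gt0P;
  exists x0.
move=> e; apply: (fmorph_inj (ratr : rat -> K)); apply: (mulfI XK).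
by rewrite [RHS]e expr2 !rmorphM !rmorph_nat mulrCA.
Unshelve. all: by end_near.
Qed.

End Torsion.

(** * Counting the words *)

(* [max 0 (1 + z) = 1 + z + defect z]. *)
Definition defect (z : int) : int := Num.max 0 (- 1 - z).

Lemma defect_neg (z : int) : z < 0 -> defect z = - 1 - z.
Proof. by move=> z0; apply/max_idPr; lia. Qed.

Lemma defect_nneg (z : int) : - 1 <= z -> defect z = 0.
Proof. by move=> z0; apply/max_idPl; lia. Qed.

(** The indicator of [0 <= y] is 1 plus a first difference of [defect]. Summing it over one index
    telescopes, and the range of the other index gives a second difference. *)
Lemma count_pairs (n : nat) (z : int) :
  \sum_(l : 'I_n * 'I_n | (l.1 + l.2)%N%:Z == z) (1 : int) =
  defect z - 2 * defect (z - n%:Z) + defect (z - (2 * n)%N%:Z).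
Proof.
pose step (y : int) : int := if 0 <= y then 1 else 0.
have stepE y : step y = 1 - defect (y - 1) + defect y.
  rewrite /step; case: (lerP 0 y) => y0.
    by rewrite !defect_nneg; lia.
  by rewrite !defect_neg; lia.
have sum_step y : \sum_(i < n) step (y - i%:Z) = n%:Z + defect y - defect (y -
  n%:Z).
  elim: (n) => [|m IH]; first by rewrite big_ord0 subr0 add0r subrr.
  rewrite big_ord_recr /= IH stepE (_ : y - m%:Z - 1 = y - m.+1%:Z); lia.
rewrite big_mkcond -(pair_bigA _ (fun i j : 'I_n =>
  if (i + j)%N%:Z == z then 1 else 0 : int)) /=.
rewrite (eq_bigr (fun i : 'I_n => step (z - i%:Z) - step ((z - n%:Z) - i%:Z))).
  rewrite sumrB !sum_step (_ : z - n%:Z - n%:Z = z - (2 * n)%N%:Z);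
    first by ring.
  by lia.
move=> i _.
case: (boolP ((0 <= z - i%:Z) && (z - n%:Z - i%:Z < 0))) => [/andP[h1 h2]|h].
  have h3 : (absz (z - i%:Z) < n)%N by lia.
  rewrite (bigD1 (Ordinal h3)) //= big1 => [|j]; last first.
    by rewrite -val_eqE /= => ne; case: eqP => // e; move: ne; rewrite -e; lia.
  rewrite /step h1 leNgt h2 /= (_ : (i + _)%N%:Z == z) ?addr0 ?subr0 //; lia.
rewrite big1 => [|j _].
  rewrite /step; move: h; case: (lerP 0 (z - i%:Z));
    case: (lerP 0 (z - n%:Z - i%:Z)) => //.
  by lia.
by case: eqP => // e; have := ltn_ord j; lia.
Qed.

Section Counting.
Variable M : seifert.
Local Notation p := (alpha_lcm M).

(* alpha |e| *)
Definition orbifold_order : nat :=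
  absz (\sum_(i < nu M) beta i * (p %/ alpha i)%N%:Z).
Local Notation n := orbifold_order.

(* The words [g_0 ^ base_degree m * \prod_i g_i ^ fibre_residue m i] with
   [0 <= base_degree m] are the reduced words equal to 1 in H. *)
Definition fibre_residue (m : nat) (i : 'I_(nu M)) : nat :=
  absz ((m%:Z * beta i) %% alpha i)%Z.

Definition base_degree (m : nat) : int :=
  - (m%:Z * seif_b M) + \sum_(i < nu M) ((- (m%:Z * omega i)) %/ alpha i)%Z.

Lemma alpha_neq0 (i : 'I_(nu M)) : (alpha i : int) != 0.
Proof. by have := alpha_gt0 i; lia. Qed.

Lemma fibre_residueE (m : nat) (i : 'I_(nu M)) :
  ((- (m%:Z * omega i)) %% alpha i)%Z = fibre_residue m i.
Proof.
rewrite /fibre_residue gez0_abs ?modz_ge0 ?alpha_neq0 //.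
by rewrite /omega -modzNm modzMmr modzNm mulrN opprK.
Qed.

Lemma fibre_residue_lt (m : nat) (i : 'I_(nu M)) : (fibre_residue m i < alpha
  i)%N.
Proof.
have : (fibre_residue m i < alpha i :> int).
  by rewrite -fibre_residueE; apply: ltz_pmod; exact: alpha_gt0.
by [].
Qed.

(** The Dolgachev-Pinkham terms are the corrections in the count of words. *)
Lemma DP_termE (m : nat) : DP_term M m = defect (base_degree m).
Proof.
rewrite /DP_term /defect /base_degree; congr (Num.max _ _).
rewrite opprD opprK addrA; congr (_ - _); apply: eq_bigr => i _.
by rewrite -(floor_divz rat _ (alpha_gt0 i)) intrN intrM.
Qed.

(** The integral form of [eulerE], multiplied by [p]. *)
Lemma weighted_seif_b :
  p%:Z * seif_b M + \sum_(i < nu M) (p %/ alpha i)%N%:Z * omega i =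
  - \sum_(i < nu M) beta i * (p %/ alpha i)%N%:Z.
Proof.
rewrite /seif_b mulr_sumr -big_split -sumrN /=; apply: eq_bigr => i _.
rewrite -mulNr [in RHS](divz_eq (- beta i) (alpha i)) -/(omega i).
by rewrite -{1}(mul_alpha_lcm i) PoszM; ring.
Qed.

Hypothesis e_lt0 : euler M < 0.

Lemma alpha_lcm_euler :
  (\sum_(i < nu M) beta i * (p %/ alpha i)%N%:Z)%:~R = p%:R * - euler M :> rat.
Proof.
rewrite rmorph_sum /euler opprK mulr_sumr; apply: eq_bigr => i _ /=.
have a0 : (alpha i)%:R != 0 :> rat by rewrite pnatr_eq0 -lt0n alpha_gt0.
by rewrite intrM -[in RHS](mul_alpha_lcm i) natrM -[(_%:Z)%:~R]/(_%:R); field.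
Qed.

Lemma orbifold_orderE :
  (n : int) = \sum_(i < nu M) beta i * (p %/ alpha i)%N%:Z.
Proof.
rewrite gez0_abs // -(ler_int rat) alpha_lcm_euler.
by rewrite pmulr_rge0 ?ltr0n ?alpha_lcm_gt0 // oppr_ge0 ltW.
Qed.

Lemma eulerE_order : euler M = - (n%:R / p%:R).
Proof.
have p0 : p%:R != 0 :> rat by rewrite pnatr_eq0 -lt0n alpha_lcm_gt0.
rewrite -[n%:R]/((n : int)%:~R) orbifold_orderE alpha_lcm_euler.
by field.
Qed.

Lemma orbifold_order_gt0 : (0 < n)%N.
Proof.
rewrite lt0n; apply: contraTneq e_lt0 => n0.
by rewrite eulerE_order n0 mul0r oppr0 ltxx.
Qed.

(** In each fibre [alpha i] times the quotient plus the residue restores the dividend. The identity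
    says that the word of index [m] has degree [m * n]. *)
Lemma base_degreeE (m : nat) :
  p%:Z * base_degree m + \sum_(i < nu M) (fibre_residue m i * (p %/ alpha
    i))%N%:Z
  = m%:Z * n.
Proof.
rewrite orbifold_orderE -[RHS]opprK -mulrN -weighted_seif_b /base_degree.
rewrite [in LHS]mulrDr [X in _ + X + _]mulr_sumr -addrA -big_split mulrDr opprD.
rewrite [X in _ = _ - X]mulr_sumr -sumrN /=.
congr (_ + _); first by ring.
apply: eq_bigr => i _; rewrite PoszM -fibre_residueE.
set q := (- (m%:Z * omega i)); rewrite -{1}(mul_alpha_lcm i) PoszM.
have -> : - (m%:Z * ((p %/ alpha i)%N%:Z * omega i)) = (p %/ alpha i)%N%:Z * q
  by rewrite /q; ring.
by rewrite {3}(divz_eq q (alpha i)); ring.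
Qed.

(** As [alpha i] divides [p], the shift by [p] leaves every quotient through an exact integer. *)
Lemma base_degreeD (m : nat) : base_degree (m + p) = base_degree m + n.
Proof.
rewrite orbifold_orderE -[X in _ + X]opprK -weighted_seif_b /base_degree.
have -> : \sum_(i < nu M) ((- ((m + p)%N%:Z * omega i)) %/ alpha i)%Z =
    \sum_(i < nu M) ((- (m%:Z * omega i)) %/ alpha i)%Z
    - \sum_(i < nu M) (p %/ alpha i)%N%:Z * omega i.
  rewrite -sumrB; apply: eq_bigr => i _.
  have -> : - ((m + p)%N%:Z * omega i) = - ((p %/ alpha i)%N%:Z * omega i) *
    alpha i + - (m%:Z * omega i).
    by rewrite -{1}(mul_alpha_lcm i) PoszD PoszM; ring.
  by rewrite divzMDl ?alpha_neq0 // addrC.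
by rewrite PoszD; ring.
Qed.

Lemma base_degree_lt (k m : nat) : (m < k * p)%N -> base_degree m < (k * n)%N.
Proof.
move=> mk; have p0 : 0 < p%:Z by rewrite ltz_nat alpha_lcm_gt0.
rewrite -(ltr_pM2l p0) -[X in X < _](addrK (\sum_(i < nu M) (fibre_residue m i
  * (p %/ alpha i))%N%:Z)).
rewrite base_degreeE; apply: (@le_lt_trans _ _ (m%:Z * n)).
  by rewrite lerBlDr lerDl sumr_ge0.
by rewrite -!PoszM ltz_nat mulnCA mulnA ltn_pmul2r ?orbifold_order_gt0 // mulnC.
Qed.

(** Each fibre term of [base_degreeE] is at most [p], and [n] is at least 1. *)
Lemma base_degree_large (k m : nat) : ((k + nu M) * p <= m)%N ->
  (k : int) <= base_degree m.
Proof.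
move=> km; have p0 : 0 < p%:Z by rewrite ltz_nat alpha_lcm_gt0.
rewrite -(ler_pM2l p0) -[X in _ <= X](addrK (\sum_(i < nu M) (fibre_residue m
  i * (p %/ alpha i))%N%:Z)).
rewrite base_degreeE lerBrDr.
apply: (@le_trans _ _ (p%:Z * k + \sum_(i < nu M) p%:Z)).
  rewrite lerD2l; apply: ler_sum => i _.
  by rewrite lez_nat -{2}(mul_alpha_lcm i) leq_mul2r ltnW ?orbT
    ?fibre_residue_lt.
rewrite sumr_const card_ord -mulr_natr -mulrDr -!PoszM.
have -> : (k%:Z + (nu M)%:R) = (k + nu M)%N by rewrite PoszD natz.
rewrite -PoszM lez_nat mulnC (leq_trans km) // leq_pmulr //.
exact: orbifold_order_gt0.
Qed.

(** * Words that are trivial in the presented group *)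

Section Presented.
Variables (H : zmodType) (g : option 'I_(nu M) -> H).
Hypothesis gP : presented (@seif_rel M) g.

Lemma seif_relE (c : option 'I_(nu M) -> int) :
  (\sum_j c j * seif_rel j None = c None * seif_b M + \sum_i c (Some i)) /\
  (forall i, \sum_j c j * seif_rel j (Some i) =
     c None * omega i - c (Some i) * (alpha i)%:Z).
Proof.
split=> [|i]; rewrite big_option /=; congr (_ + _).
  by apply: eq_bigr => i _; rewrite mulr1.
rewrite (bigD1 i) //= eqxx big1 ?addr0 ?mulrN // => j ji.
by rewrite (negbTE ji) mulr0.
Qed.

Lemma presented_eq0 (k0 : int) (k : 'I_(nu M) -> int) :
  g None *~ k0 + \sum_i g (Some i) *~ k i = 0 <->
  exists c0 (c : 'I_(nu M) -> int), k0 = c0 * seif_b M + \sum_i c i /\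
    forall i, k i = c0 * omega i - c i * (alpha i)%:Z.
Proof.
have := gP.2 (fun j => if j is Some i then k i else k0).
rewrite big_option /= => ->; split=> [[c cE]|[c0 [c [c0E cE]]]].
  exists (c None), (fun i => c (Some i)); split.
    by rewrite (cE None) (seif_relE c).1.
  by move=> i; rewrite (cE (Some i)) (seif_relE c).2.
exists (fun j => if j is Some i then c i else c0) => -[i|].
  by rewrite (seif_relE _).2 cE.
by rewrite (seif_relE _).1 c0E.
Qed.

Lemma presented_alpha (i : 'I_(nu M)) : g (Some i) *+ alpha i = g None.
Proof.
have : g None *~ 1 + \sum_j g (Some j) *~ (if j == i then - (alpha i)%:Z else
  0) = 0.
  apply/presented_eq0; exists 0, (fun j => if j == i then 1 else 0).
  split=> [|j]; first by rewrite mul0r add0r -big_mkcond big_pred1_eq.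
  by case: eqP => [->|_]; rewrite mul0r sub0r ?mul1r ?mul0r ?oppr0.
rewrite (bigD1 i) //= eqxx big1 ?addr0 => [|j ji];
  last by rewrite (negbTE ji) mulr0z.
by rewrite mulr1z mulrNz pmulrn => /eqP; rewrite subr_eq0 => /eqP.
Qed.

(** Taking the central relation [- p] times, the multiples of the fibre relations are chosen to
    cancel every [g (Some i)]; [weighted_seif_b] gives the exponent left on [g None]. *)
Lemma presented_order : g None *+ n = 0.
Proof.
have : g None *~ n%:Z + \sum_i g (Some i) *~ 0 = 0.
  apply/presented_eq0.
  exists (- p%:Z), (fun i => - ((p %/ alpha i)%N%:Z * omega i)); split=> [|i].
    by rewrite orbifold_orderE -[LHS]opprK -weighted_seif_b sumrN; ring.
  by rewrite -{1}(mul_alpha_lcm i) PoszM; ring.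
by rewrite big1 ?addr0 ?pmulrn // => i _; rewrite mulr0z.
Qed.

(** The index [m] is minus the coefficient [c0] of the central relation; the degree equals
    [- c0 * n], whence [c0 <= 0]. Reducedness makes exponents and remaining coefficients the
    remainders and quotients of a division by [alpha i]. *)
Lemma expansion_elt_eq0 (k : nat) (x : expansion_index M k) : reduced x ->
  expansion_elt g x = 0 <->
  exists m : nat, (forall i, x.1 i = fibre_residue m i :> nat) /\
    (x.2.1 + x.2.2)%N%:Z = base_degree m.
Proof.
move=> /forallP red.
have -> : expansion_elt g x =
    g None *~ (x.2.1 + x.2.2)%N%:Z + \sum_i g (Some i) *~ (x.1 i)%:Z.
  by rewrite /expansion_elt addrC.
rewrite presented_eq0; split=> [[c0 [c [c0E cE]]]|[m [mE dE]]]; last first.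
  exists (- m%:Z), (fun i => (- (m%:Z * omega i) %/ alpha i)%Z); split=> [|i].
    by rewrite dE /base_degree mulNr.
  by rewrite mE -fibre_residueE mulNr {2}(divz_eq (- (m%:Z * omega i)) (alpha
    i)) addrC addKr.
have c0n : - c0 * n = p%:Z * (x.2.1 + x.2.2)%N%:Z
    + \sum_i (x.1 i * (p %/ alpha i))%N%:Z.
  rewrite orbifold_orderE mulNr -mulrN -weighted_seif_b c0E.
  move: (seif_b M) => b; rewrite !mulrDr !mulr_sumr -addrA -big_split.
  congr (_ + _); first by ring.
  apply: eq_bigr => i _; rewrite PoszM cE -{2}(mul_alpha_lcm i) PoszM.
  by rewrite /=; ring.
have c0m : c0 <= 0.
  have : 0 <= - c0 * n.
    by rewrite c0n addr_ge0 ?sumr_ge0.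
  by rewrite pmulr_lge0 ?oppr_ge0 // ltz_nat orbifold_order_gt0.
have mE : (absz c0)%:Z = - c0 by rewrite -abszN gez0_abs ?oppr_ge0.
have divE i : (- ((absz c0)%:Z * omega i))%R = c i * alpha i + (x.1 i)%:Z.
  by rewrite mE cE; ring.
have lt i : 0 <= (x.1 i)%:Z < `|(alpha i)%:Z| by rewrite /= ltz_nat red.
exists (absz c0); split=> [i|].
  by apply/eqP; rewrite -eqz_nat -fibre_residueE divE modzMDl modz_small.
rewrite c0E /base_degree mE mulNr opprK; congr (_ + _).
apply: eq_bigr => i _; have := divE i; rewrite mE => ->.
by rewrite divzMDl ?alpha_neq0 // divz_small // addr0.
Qed.

(** The degree [m * n] of a trivial word determines [m], and words with the same [m] differ only in
    how the exponent of [g None] splits in two. Two indices below [k] never add up to [2 * k], which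
    bounds [m] by [L]. *)
Lemma sum_expansions (k L : nat) (F : nat -> rat) :
  (forall m, (L <= m)%N -> (2 * k)%N%:Z <= base_degree m) ->
  \sum_(x : expansion_index M k | reduced x && (expansion_elt g x == 0))
     F (expansion_degree x) =
  \sum_(0 <= m < L) F (m * n)%N
    * (\sum_(l : 'I_k * 'I_k | (l.1 + l.2)%N%:Z == base_degree m) (1 :
      int))%:~R.
Proof.
move=> Lk.
have p_gt : (0 < p)%N := alpha_lcm_gt0 M.
have res_lt m i : (fibre_residue m i < p)%N.
  by rewrite (leq_trans (fibre_residue_lt m i)) ?leq_alpha_lcm.
pose x_of (y : 'I_L * ('I_k * 'I_k)) : expansion_index M k :=
  ([ffun i => Ordinal (res_lt y.1 i)], y.2).
have red y : reduced (x_of y).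
  by apply/forallP => i; rewrite ffunE fibre_residue_lt.
have deg (x : expansion_index M k) (m : nat) :
    (forall i, x.1 i = fibre_residue m i :> nat) ->
    (x.2.1 + x.2.2)%N%:Z = base_degree m -> expansion_degree x = (m * n)%N.
  move=> xE dE; apply/eqP; rewrite -eqz_nat PoszM -base_degreeE -dE -PoszM.
  rewrite (_ : \sum_(i < nu M) _ = (\sum_(i < nu M) fibre_residue m i * (p %/
    alpha i))%N%:Z).
    rewrite -PoszD eqz_nat /expansion_degree addnC mulnC; apply/eqP; congr addn.
    by apply: eq_bigr => i _; rewrite xE.
  by rewrite -[RHS]natz natr_sum; apply: eq_bigr => i _; rewrite natz.
pose m_of (x : expansion_index M k) := (expansion_degree x %/ n)%N.
have m_ofE m x : expansion_degree x = (m * n)%N -> m_of x = m.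
  by move=> e; rewrite /m_of e mulnK ?orbifold_order_gt0.
have small m (x : expansion_index M k) :
    (x.2.1 + x.2.2)%N%:Z = base_degree m -> (m < L)%N.
  move=> dE; rewrite ltnNge; apply/negP => /Lk; rewrite -dE lez_nat leqNgt.
  by rewrite mul2n -addnn -addSn leq_add ?ltn_ord // ltnW ?ltn_ord.
(* The inverse is partial: the quotient is known to lie below [L] only for trivial words. *)
pose y_of (x : expansion_index M k) : option ('I_L * ('I_k * 'I_k)) :=
  omap (fun m => (m, x.2)) (insub (m_of x)).
rewrite big_mkord.
under [RHS]eq_bigr => m _ do rewrite rmorph_sum mulr_sumr.
rewrite pair_big_dep /= [RHS](eq_bigr (fun y =>
  F (expansion_degree (x_of y)))); last first.
  move=> [m l] /= /eqP lE; rewrite (deg (x_of (m, l)) m) ?mulr1 //.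
  by move=> i; rewrite ffunE.
have y_ofE x m (mL : (m < L)%N) : m_of x = m -> y_of x = Some (Ordinal mL, x.2).
  by move=> mE; rewrite /y_of mE insubT.
rewrite (reindex_omap x_of y_of) => [|x /andP[redx /eqP]]; last first.
  rewrite expansion_elt_eq0 // => -[m [mE dE]].
  have mo : m_of x = m by apply: m_ofE; exact: deg.
  rewrite (y_ofE x m (small m x dE) mo) /=.
  congr Some; rewrite [RHS]surjective_pairing; congr pair; apply/ffunP => i.
  by apply: val_inj; rewrite ffunE /= mE.
apply: eq_bigl => -[m l] /=; rewrite red /=.
apply/andP/eqP => [[/eqP]|lE].
  rewrite expansion_elt_eq0 // => -[m' [mE dE]].
  have mo : m_of (x_of (m, l)) = m' by apply: m_ofE; exact: deg.
  rewrite (y_ofE _ m' (small m' _ dE) mo) => /eqP[mm].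
  by rewrite dE -mm.
have xE i : (x_of (m, l)).1 i = fibre_residue m i :> nat by rewrite ffunE.
split; first by apply/eqP; rewrite expansion_elt_eq0 //; exists m.
have mo : m_of (x_of (m, l)) = m by apply: m_ofE; exact: deg.
apply/eqP; rewrite (y_ofE _ m (ltn_ord m) mo).
by congr (Some (_, _)); apply: val_inj.
Qed.

End Presented.

(** * Summation over a period *)

(** Summation by parts: subtracting [n] from the base degree is a shift of [m] by [p], which moves
    onto [F]. The indices without a predecessor form the first period, where the shifted degrees are
    negative and [defect] is affine. *)
Lemma sum_second_difference (K L : nat) (F : nat -> rat) : (K <= L)%N ->
  (forall m, (K <= m)%N -> defect (base_degree m) = 0) ->
  \sum_(0 <= m < L + (p + p)) F m * (defect (base_degree m)
     - 2 * defect (base_degree m - n%:Z)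
     + defect (base_degree m - (2 * n)%N%:Z))%:~R
  = \sum_(0 <= m < K) (defect (base_degree m))%:~R
       * (F m - 2 * F (m + p)%N + F (m + (p + p))%N)
    + \sum_(m < p) ((1 + base_degree m)%:~R * F m
       + (n%:Z - 1 - base_degree m)%:~R * F (m + p)%N).
Proof.
move=> KL D0.
have trunc (L' : nat) (G : nat -> rat) : (K <= L')%N ->
    \sum_(0 <= m < L') G m * (defect (base_degree m))%:~R =
    \sum_(0 <= m < K) (defect (base_degree m))%:~R * G m.
  move=> KL'; rewrite (big_cat_nat (leq0n K) KL') /= [X in _ + X]big1_seq
    ?addr0.
    by apply: eq_bigr => m _; rewrite mulrC.
  by move=> m; rewrite mem_index_iota => /and3P[_ Km _]; rewrite D0 // mulr0.
have split_p (L' : nat) (G : nat -> rat) :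
    \sum_(0 <= m < L' + p) G m = \sum_(m < p) G m + \sum_(0 <= m < L') G (m +
      p)%N.
  rewrite (big_cat_nat (leq0n p) (leq_addl L' p)) /= big_mkord; congr (_ + _).
  by rewrite -{1}[p]add0n big_addn addnK.
have lt1 m : (m < p)%N -> defect (base_degree m - n%:Z) = n%:Z - 1 -
  base_degree m.
  move=> mp; have := @base_degree_lt 1 m; rewrite !mul1n => /(_ mp) h.
  by rewrite defect_neg; lia.
have lt2 m : (m < p)%N ->
    defect (base_degree m - (2 * n)%N%:Z) = (2 * n)%N%:Z - 1 - base_degree m.
  move=> mp; have := @base_degree_lt 1 m; rewrite !mul1n => /(_ mp) h.
  by rewrite defect_neg; lia.
have sum1 : \sum_(0 <= m < L + (p + p)) F m * (defect (base_degree m -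
  n%:Z))%:~R =
    \sum_(m < p) F m * (n%:Z - 1 - base_degree m)%:~R +
    \sum_(0 <= m < K) (defect (base_degree m))%:~R * F (m + p)%N.
  rewrite addnA split_p; congr (_ + _); first by apply: eq_bigr => m _;
    rewrite lt1.
  rewrite -(trunc (L + p)%N (fun m => F (m + p)%N));
    last by rewrite (leq_trans KL) ?leq_addr.
  by apply: eq_bigr => m _; rewrite base_degreeD addrK.
have sum2 : \sum_(0 <= m < L + (p + p)) F m * (defect (base_degree m - (2 *
  n)%N%:Z))%:~R =
    \sum_(m < p) F m * ((2 * n)%N%:Z - 1 - base_degree m)%:~R +
    (\sum_(m < p) F (m + p)%N * (n%:Z - 1 - base_degree m)%:~R +
    \sum_(0 <= m < K) (defect (base_degree m))%:~R * F (m + (p + p))%N).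
  have sub m : base_degree (m + p) - (2 * n)%N%:Z = base_degree m - n%:Z.
    by rewrite base_degreeD mul2n -addnn PoszD; ring.
  rewrite addnA !split_p; congr (_ + (_ + _)).
  - by apply: eq_bigr => m _; rewrite lt2.
  - by apply: eq_bigr => m _; rewrite sub lt1.
  rewrite -(trunc L (fun m => F (m + (p + p))%N)) //.
  by apply: eq_bigr => m _; rewrite sub base_degreeD addrK addnA.
rewrite (eq_bigr (fun m => F m * (defect (base_degree m))%:~R
   - 2 * (F m * (defect (base_degree m - n%:Z))%:~R)
   + F m * (defect (base_degree m - (2 * n)%N%:Z))%:~R)); last first.
  by move=> m _; rewrite intrD intrB intrM; ring.
rewrite big_split sumrB /= -mulr_sumr sum1 sum2 trunc; last first.
  by rewrite (leq_trans KL) ?leq_addr.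
rewrite [X in _ = X + _](eq_bigr (fun m => (defect (base_degree m))%:~R * F m
   - 2 * ((defect (base_degree m))%:~R * F (m + p)%N)
   + (defect (base_degree m))%:~R * F (m + (p + p))%N)); last by move=> m _;
     ring.
rewrite [X in _ = _ + X](eq_bigr (fun m : 'I_p =>
  F m * ((2 * n)%N%:Z - 1 - base_degree m)%:~R
   - 2 * (F m * (n%:Z - 1 - base_degree m)%:~R)
   + F (m + p)%N * (n%:Z - 1 - base_degree m)%:~R)); last first.
  by move=> m _; rewrite !(intrD, intrN) PoszM intrM; ring.
rewrite [X in _ = X + _]big_split [X in _ = _ + X]big_split /= !sumrB
  -!mulr_sumr.
by do ?[move: (bigop _ _ _) => ?]; ring.
Qed.

Lemma DP_big_nat (K : nat) :
  (forall m, (K <= m)%N -> defect (base_degree m) = 0) ->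
  DP M = \sum_(0 <= m < K) defect (base_degree m).
Proof.
move=> D0; rewrite /DP -(fsbig_widen `I_K) //=; last first.
  by move=> m [_ /=] /negP; rewrite -leqNgt => Km; rewrite DP_termE D0.
by rewrite -fsbig_ord big_mkord; apply: eq_bigr => m _; rewrite DP_termE.
Qed.

Lemma fibre_residue_modn (m : nat) (i : 'I_(nu M)) :
  (fibre_residue m i)%:R = ((beta i * m) %% alpha i)%Z%:~R :> rat.
Proof.
by rewrite -[LHS]/((fibre_residue m i)%:Z%:~R) /fibre_residue gez0_abs
  ?modz_ge0 ?alpha_neq0 // mulrC.
Qed.

Lemma sum_periods (i : 'I_(nu M)) (F : nat -> rat) :
  \sum_(m < p) F m =
  \sum_(j < p %/ alpha i) \sum_(r < alpha i) F (j * alpha i + r)%N.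
Proof.
rewrite -(big_mkord xpredT F) -[X in index_iota 0 X](mul_alpha_lcm i) mulnC
  big_mkord.
elim: (p %/ alpha i)%N => [|k IH]; first by rewrite mul0n !big_ord0.
rewrite big_ord_recr /= -IH mulSn addnC big_split_ord /=.
by congr (_ + _); apply: eq_bigr => r _.
Qed.

Lemma fibre_residueD (i : 'I_(nu M)) (j r : nat) :
  fibre_residue (j * alpha i + r) i = fibre_residue r i.
Proof.
rewrite /fibre_residue PoszD PoszM mulrDl mulrAC modzMDl //.
Qed.

Lemma sum_fibre_residue (i : 'I_(nu M)) :
  \sum_(m < p) (fibre_residue m i)%:R = p%:R * ((alpha i)%:R - 1) / 2 :> rat.
Proof.
have a0 : (alpha i)%:R != 0 :> rat by rewrite pnatr_eq0 -lt0n alpha_gt0.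
rewrite (sum_periods i (fun m => (fibre_residue m i)%:R)).
rewrite (eq_bigr (fun=> (alpha i)%:R * ((alpha i)%:R - 1) / 2)).
  rewrite sumr_const card_ord -mulr_natl -[in RHS](mul_alpha_lcm i) natrM.
  by field.
move=> j _; under eq_bigr do rewrite fibre_residueD fibre_residue_modn.
rewrite (sum_mulmodz (fun z => z%:~R)) ?alpha_gt0 ?alpha_beta_coprime //.
exact: sumr_ord.
Qed.

(** Writing [m = j * alpha i + r], the part in [r] gives the Dedekind sum, while the part in [j]
    only meets the plain sum of residues. *)
Lemma sum_weighted_fibre_residue (i : 'I_(nu M)) :
  (p %/ alpha i)%:R * \sum_(m < p) m%:R * (fibre_residue m i)%:R =
  p%:R ^+ 2 * dedekind_sum (beta i) (alpha i)
  + p%:R ^+ 2 * ((p %/ alpha i)%:R * ((alpha i)%:R - 1)) / 4 :> rat.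
Proof.
have a0 : (alpha i)%:R != 0 :> rat by rewrite pnatr_eq0 -lt0n alpha_gt0.
rewrite dedekind_sum_coprime ?alpha_gt0 ?alpha_beta_coprime //.
rewrite (sum_periods i (fun m => m%:R * (fibre_residue m i)%:R)).
set D := \sum_(r < alpha i) _ * _.
rewrite (eq_bigr (fun j : 'I_(p %/ alpha i) =>
  D + (alpha i)%:R * ((alpha i)%:R * ((alpha i)%:R - 1) / 2) * j%:R)).
  rewrite big_split /= sumr_const card_ord -mulr_sumr sumr_ord -mulr_natl.
  by rewrite -[in p%:R](mul_alpha_lcm i) natrM; field.
move=> j _.
rewrite (eq_bigr (fun r : 'I_(alpha i) => r%:R * ((beta i * r) %% alpha i)%Z%:~R
   + j%:R * (alpha i)%:R * ((beta i * r) %% alpha i)%Z%:~R)).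
  rewrite big_split /= -mulr_sumr (sum_mulmodz (fun z =>
    z%:~R)) ?alpha_gt0 ?alpha_beta_coprime //.
  by rewrite sumr_ord -/D; ring.
by move=> r _; rewrite fibre_residueD fibre_residue_modn natrD natrM; ring.
Qed.

Lemma base_degree_rat (m : nat) :
  (base_degree m)%:~R = (m%:R * n%:R
    - \sum_(i < nu M) (fibre_residue m i)%:R * (p %/ alpha i)%:R) / p%:R :> rat.
Proof.
have p0 : p%:R != 0 :> rat by rewrite pnatr_eq0 -lt0n alpha_lcm_gt0.
have := congr1 (fun z : int => z%:~R : rat) (base_degreeE m).
rewrite intrD !intrM rmorph_sum /= => e; apply: (mulfI p0).
rewrite -[RHS]mulrC divfK //; apply/eqP; rewrite eq_sym subr_eq; apply/eqP.
transitivity (m%:~R * n%:~R : rat); first by [].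
rewrite -e; congr (_ + _).
by apply: eq_bigr => i _; rewrite PoszM intrM.
Qed.

(** The base degree multiplies [q m - q (m + p)], which is affine in [m]. The summand is therefore
    linear in the residues, and only the sums of [S m] and [m * S m] are needed. *)
Lemma sum_boundary :
  let q (m : nat) : rat := ((m * n)%:R - degree_mean M n) ^+ 2 -
    degree_variance M n in
  \sum_(m < p) ((1 + base_degree m)%:~R * q m
      + (n%:Z - 1 - base_degree m)%:~R * q (m + p)%N)
  = 2 * (n * p)%:R ^+ 2 / 24 *
    (3 * ((2 - (nu M)%:R + \sum_(i < nu M) (alpha i)%:R^-1) ^+ 2 / euler M)
     - (euler M)^-1 * (2 - (nu M)%:R + \sum_(i < nu M) ((alpha i)%:R ^+ 2)^-1)
     + 2 * euler M + 12 + 24 * \sum_(i < nu M) dedekind_sum (beta i) (alpha i)).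
Proof.
move=> q.
have p0 : p%:R != 0 :> rat by rewrite pnatr_eq0 -lt0n alpha_lcm_gt0.
have n0 : n%:R != 0 :> rat by rewrite pnatr_eq0 -lt0n orbifold_order_gt0.
have nuE : (nu M)%:R = \sum_(i < nu M) 1 :> rat by rewrite sumr_const card_ord.
have dE (i : 'I_(nu M)) : (p %/ alpha i)%:R = p%:R / (alpha i)%:R :> rat.
  have a0 : (alpha i)%:R != 0 :> rat by rewrite pnatr_eq0 -lt0n alpha_gt0.
  by rewrite -{2}(mul_alpha_lcm i) natrM mulrC mulKf.
pose S (m : nat) : rat := \sum_(i < nu M) (fibre_residue m i)%:R * (p %/ alpha
  i)%:R.
pose I1 : rat := \sum_(i < nu M) (alpha i)%:R^-1.
pose I2 : rat := \sum_(i < nu M) ((alpha i)%:R ^+ 2)^-1.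
pose B : rat := \sum_(i < nu M) dedekind_sum (beta i) (alpha i).
pose A : rat := p%:R * ((nu M)%:R - I1) / 2.
have AE : \sum_(i < nu M) (p %/ alpha i)%:R * ((alpha i)%:R - 1) / 2 = A.
  rewrite /A /I1 nuE -sumrB.
  rewrite mulr_sumr mulr_suml; apply: eq_bigr => i _.
  have a0 : (alpha i)%:R != 0 :> rat by rewrite pnatr_eq0 -lt0n alpha_gt0.
  by rewrite dE; field.
have S0 : \sum_(m < p) S m = p%:R * A.
  rewrite exchange_big /= -AE mulr_sumr; apply: eq_bigr => i _.
  by rewrite -mulr_suml sum_fibre_residue; ring.
have S1 : \sum_(m < p) m%:R * S m = p%:R ^+ 2 * (B + A / 2).
  rewrite -AE mulr_suml -big_split mulr_sumr /=.
  under eq_bigr do rewrite mulr_sumr.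
  rewrite exchange_big /=; apply: eq_bigr => i _.
  under eq_bigr do rewrite mulrA.
  by rewrite -mulr_suml mulrC sum_weighted_fibre_residue; field.
have meanE : degree_mean M n = A + p%:R * (n%:R - 1) by rewrite /degree_mean AE.
have varE : degree_variance M n =
    p%:R ^+ 2 * ((nu M)%:R - I2) / 12 + p%:R ^+ 2 * (n%:R ^+ 2 - 1) / 6.
  rewrite /degree_variance; congr (_ + _).
  rewrite /I2 nuE -sumrB.
  rewrite mulr_sumr mulr_suml; apply: eq_bigr => i _.
  have a0 : (alpha i)%:R != 0 :> rat by rewrite pnatr_eq0 -lt0n alpha_gt0.
  by rewrite dE; field.
pose mu := degree_mean M n; pose v := degree_variance M n.
pose c0 : rat := n%:R * (p%:R * n%:R - mu) ^+ 2 - n%:R * v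
  - n%:R * p%:R * (p%:R * n%:R - 2 * mu).
pose c1 : rat := 2 * n%:R ^+ 2 * (p%:R * n%:R - mu) - 2 * n%:R ^+ 2 * p%:R
  - n%:R ^+ 2 * (p%:R * n%:R - 2 * mu).
pose c2 : rat := n%:R * (p%:R * n%:R - 2 * mu).
rewrite (eq_bigr (fun m : 'I_p => c0 + c1 * m%:R - n%:R ^+ 3 * m%:R ^+ 2
    + c2 * S m + 2 * n%:R ^+ 2 * (m%:R * S m))); last first.
  move=> m _; have := base_degree_rat m; move: (base_degree m) => N NE.
  rewrite /q !intrD !intrN NE -/(S m) natrM natrM natrD -/mu -/v /c0 /c1 /c2.
  rewrite -[(n%:Z)%:~R]/(n%:R).
  by field.
have lin (a0 a1 a2 a3 a4 : rat) : \sum_(m < p) (a0 + a1 * m%:R - a2 * m%:R ^+ 2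
    + a3 * S m + a4 * (m%:R * S m)) =
  a0 * p%:R + a1 * (\sum_(m < p) m%:R) - a2 * (\sum_(m < p) m%:R ^+ 2)
    + a3 * (p%:R * A) + a4 * (p%:R ^+ 2 * (B + A / 2)).
  rewrite !big_split /= sumrN -!mulr_sumr sumr_const card_ord.
  by rewrite S0 S1 -(mulr_natr a0).
rewrite lin sumr_ord sumr_ord_sqr /c0 /c1 /c2 /mu /v varE meanE /A -/I1 -/I2
  -/B.
rewrite eulerE_order natrM.
by field; rewrite p0 n0.
Qed.

(** The moment identity is summed by parts: the defects produce [DP M], and the first period
    produces the explicit term. *)
Lemma torsion_canonical (R : realType) (H : finZmodType)
    (g : option 'I_(nu M) -> H) (gP : presented (@seif_rel M) g)
    (T : H -> rat) (TP : is_torsion_can R g T) :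
  T 0 = (DP M)%:~R + 24^-1 *
    (3 * ((2 - (nu M)%:R + \sum_(i < nu M) (alpha i)%:R^-1) ^+ 2 / euler M)
     - (euler M)^-1 * (2 - (nu M)%:R + \sum_(i < nu M) ((alpha i)%:R ^+ 2)^-1)
     + 2 * euler M + 12 + 24 * \sum_(i < nu M) dedekind_sum (beta i) (alpha i)).
Proof.
have n0 := orbifold_order_gt0.
have [K DP0] := DP_term_finite e_lt0.
have D0 m : (K <= m)%N -> defect (base_degree m) = 0.
  by move=> Km; rewrite -DP_termE DP0.
(* The first summand kills the defects; the second makes the base degree at least [2 * n]. *)
pose L := (K + (2 * n + nu M) * p)%N.
have np0 : 2 * (n * p)%:R ^+ 2 != 0 :> rat.
  by rewrite mulf_neq0 // expf_neq0 // pnatr_eq0 -lt0n muln_gt0 n0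
    alpha_lcm_gt0.
apply: (mulfI np0).
rewrite (torsion_moment n0 (presented_order gP) (presented_alpha gP) TP).
pose q (d : nat) : rat := (d%:R - degree_mean M n) ^+ 2 - degree_variance M n.
rewrite (@sum_expansions _ _ gP _ (L + (p + p)) q) => [|m Lm]; last first.
  by apply: base_degree_large; apply: leq_trans Lm; rewrite /L addnAC leq_addl.
under eq_bigr do rewrite count_pairs.
rewrite (sum_second_difference (fun m => q (m * n)%N) (leq_addr _ K) D0).
rewrite mulrDr [X in _ = _ + X]mulrA sum_boundary; congr (_ + _).
rewrite (DP_big_nat D0) rmorph_sum mulr_sumr; apply: eq_bigr => m _.
rewrite /= mulrC; congr (_ * _).
(* The second difference of the quadratic [q] with step [n * p] is the constant [2 * (n * p) ^+ 2],
   so each defect has weight 1 after division. *)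
by rewrite /q !mulnDl !natrD natrM; ring.
Qed.

End Counting.

Theorem theorem3p1 (R : realType) (M : seifert)
    (e_lt0 : euler M < 0)
    (H : finZmodType) (g : option 'I_(nu M) -> H)
    (gP : presented (@seif_rel M) g)
    (T : H -> rat) (TP : is_torsion_can R g T)
    (V : finType) (E : V -> V -> int) (EP : resolution M E)
    (ZK : V -> rat) (ZKP : canonical_cycle E ZK) :
  T 0 + casson_walker M #|H| / #|H|%:R = K2_plus_V E ZK / 8 + (DP M)%:~R.
Proof.
have e0 : euler M != 0 by rewrite lt_eqF.
have H0 : #|H|%:R != 0 :> rat.
  by rewrite pnatr_eq0 -lt0n; apply/card_gt0P; exists 0.
rewrite (resolution_K2 e0 EP ZKP) (torsion_canonical e_lt0 gP TP) /casson_walker.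
(* The terms in [(alpha i) ^- 2] cancel between torsion and Casson-Walker invariant; the rest is
   3/24 of [K2_plus_V], besides [DP M]. *)
by field; rewrite e0 H0.
Qed.
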